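(* Let $Z$ have true covariance parameter $\psi_0=(\sigma_{01}^2,\sigma_{02}^2,\rho_0,\theta_0)$. Let $$J=[a_\theta,b_\theta]\times[a_{\sigma_1},b_{\sigma_1}]\times[a_{\sigma_2},b_{\sigma_2}]\times[a_\rho,b_\rho]$$ (for the parameters $\theta,\sigma_1^2,\sigma_2^2,\rho$ in this order), where $0<a_\theta\le\theta_0\le b_\theta<\infty$, $0<a_{\sigma_1}\le\sigma_{01}^2\le b_{\sigma_1}<\infty$, $0<a_{\sigma_2}\le\sigma_{02}^2\le b_{\sigma_2}<\infty$ and $-1<a_\rho\le\rho_0\le b_\rho<1$. Define $\widehat\psi=(\hat\theta,\hat\sigma_1^2,\hat\sigma_2^2,\hat\rho)\in J$ (depending on $n$) as a solution of $$l_n(\widehat\psi)=\min_{\psi\in J}l_n(\psi).$$ Then, with probability one, $\widehat\psi$ exists for $n$ large enough, and as $n\to+\infty$ $$\hat\rho\xrightarrow{a.s.}\rho_0,\qquad \hat\theta\hat\sigma_1^2\xrightarrow{a.s.}\theta_0\sigma_{01}^2,\qquad \hat\theta\hat\sigma_2^2\xrightarrow{a.s.}\theta_0\sigma_{02}^2.$$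
   Context: For a parameter $\psi$ with components $\sigma_1^2,\sigma_2^2>0$, $|\rho|<1$, $\theta>0$, let $P_\psi$ be the law of the stationary zero-mean bivariate Gaussian process $Z(s)=(Z_1(s),Z_2(s))^\top$, $s\in[0,1]$, with $$\mathrm{Cov}_\psi(Z_i(s),Z_j(t))=\sigma_i\sigma_j\bigl(\rho+(1-\rho)\mathbf 1_{i=j}\bigr)e^{-\theta|s-t|},\qquad i,j\in\{1,2\}.$$ The process $Z$ has law $P_{\psi_0}$ for a fixed true parameter $\psi_0$ with components $\sigma_{01}^2,\sigma_{02}^2,\rho_0,\theta_0$; ''almost surely'' is with respect to $P_{\psi_0}$. For each $n$ it is observed at points $0\le s_1<\dots<s_n\le 1$ (the points may depend on $n$), which become dense in $[0,1]$ as $n\to\infty$, i.e. $\min_{1\le i\le n}|t-s_i|\to 0$ for every $t\in[0,1]$. The observation vector is $Z_n=(Z_{1,n}^\top,Z_{2,n}^\top)^\top$ with $Z_{k,n}=(Z_k(s_1),\dots,Z_k(s_n))^\top$, and the negative log-likelihood is $$l_n(\psi)=2n\log(2\pi)+\log|\Sigma(\psi)|+Z_n^\top\Sigma(\psi)^{-1}Z_n,\qquad \Sigma(\psi)=A\otimes R,$$ with $\otimes$ the Kronecker product, $A=\begin{pmatrix}\sigma_1^2&\sigma_1\sigma_2\rho\\ \sigma_1\sigma_2\rho&\sigma_2^2\end{pmatrix}$ and $R=[e^{-\theta|s_m-s_l|}]_{1\le m,l\le n}$. *)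

(* Defs.v *)
From HB Require Import structures.
From mathcomp Require Import all_boot all_order all_algebra.
From mathcomp Require Import mxtens.
From mathcomp Require Import all_classical all_reals all_analysis.

Set Implicit Arguments.
Unset Strict Implicit.
Unset Printing Implicit Defensive.

Import Order.TTheory GRing.Theory Num.Theory.
Import numFieldNormedType.Exports.

Local Open Scope classical_set_scope.
Local Open Scope ring_scope.

(* The field [sigsq] holds the variances sigma_i^2; the standard deviations are
   [sigma psi i] below. The two components of the process are indexed by 'I_2
   instead of {1, 2}. *)
Record param (R : realType) := Param {
  theta : R;
  sigsq : 'I_2 -> R;
  rho : R
}.

Definition sigma (R : realType) (psi : param R) (i : 'I_2) : R :=
  Num.sqrt (sigsq psi i).

Definition cross_cov (R : realType) (psi : param R) (i j : 'I_2) (s t : R) : R :=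
  sigma psi i * sigma psi j * (rho psi + (1 - rho psi) * (i == j)%:R)
  * expR (- theta psi * `|s - t|).

(* [normal_prob m 0] is a junk value in the library (the uniform law on [0, 1]),
   so the degenerate Gaussian law is given separately as a Dirac mass. Laws are
   compared on measurable sets only, since the value of a measure elsewhere is
   meaningless. *)
Definition gaussian_rv d (T : measurableType d) (R : realType)
    (P : probability T R) (X : {RV P >-> R}) : Prop :=
  exists m sd : R, forall B : set R, measurable B ->
    distribution P X B = if sd == 0 then \d_m B else normal_prob m sd B.

Arguments gaussian_rv {d T R} P X.

(* A bivariate process on [0, 1] is Gaussian when all finite linear combinations
   of its coordinates are Gaussian. The process is represented by a family
   indexed by all reals, whose values outside [0, 1] are unconstrained. *)
Definition gaussian_process d (T : measurableType d) (R : realType)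
    (P : probability T R) (Z : 'I_2 -> R -> {RV P >-> R}) : Prop :=
  forall (m : nat) (i : 'I_m -> 'I_2) (t c : 'I_m -> R),
    (forall k, t k \in `[0, 1]) ->
    gaussian_rv P (\sum_(k < m) (c k *: Z (i k) (t k))).

Arguments gaussian_process {d T R} P Z.
Definition has_law d (T : measurableType d) (R : realType)
    (P : probability T R) (psi : param R) (Z : 'I_2 -> R -> {RV P >-> R}) : Prop :=
  [/\ gaussian_process P Z,
      (forall i (s : R), s \in `[0, 1] -> ('E_P[Z i s] = 0)%E) &
      (forall i j (s t : R), s \in `[0, 1] -> t \in `[0, 1] ->
         covariance P (Z i s) (Z j t) = (cross_cov psi i j s t)%:E)].

Arguments has_law {d T R} P psi Z.

(* Observation points: [s n k] is the (k+1)-th of the n points of the n-th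
   design. *)
Definition design (R : realType) (s : forall n : nat, 'I_n -> R) : Prop :=
  forall n, (forall k, s n k \in `[0, 1]) /\
            (forall k l : 'I_n, (k < l)%N -> s n k < s n l).

(* All distances involved are at most 1, so the default value 1 of the minimum
   only matters for n = 0. *)
Definition becomes_dense (R : realType) (s : forall n : nat, 'I_n -> R) : Prop :=
  forall t : R, t \in `[0, 1] ->
    (\big[Num.min/1]_(k < n) `|t - s n k|) @[n --> \oo] --> (0 : R).

Definition Amx (R : realType) (psi : param R) : 'M[R]_2 :=
  \matrix_(i, j) (if i == j then sigsq psi i
                  else sigma psi i * sigma psi j * rho psi).

Definition Rmx (R : realType) (psi : param R) n (s : 'I_n -> R) : 'M[R]_n :=
  \matrix_(m, l) expR (- theta psi * `|s m - s l|).

(* [tensmx] is the Kronecker product. *)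
Definition Sigmamx (R : realType) (psi : param R) n (s : 'I_n -> R) :
    'M[R]_(2 * n) := tensmx (Amx psi) (Rmx psi s).

(* [mxtens_unindex] maps the index i * n + k to (i, k), so this vector stacks the
   n values of the first component on top of those of the second. *)
Definition obs (R : realType) n (z : 'I_2 -> R -> R) (s : 'I_n -> R) :
    'cV[R]_(2 * n) :=
  \col_k z (mxtens_unindex k).1 (s (mxtens_unindex k).2).

(* [z] is a realization of the process. *)
Definition nll (R : realType) n (z : 'I_2 -> R -> R) (s : 'I_n -> R)
    (psi : param R) : R :=
  (2 * n)%:R * ln (2 * pi) + ln (\det (Sigmamx psi s))
  + ((obs z s)^T *m invmx (Sigmamx psi s) *m obs z s) 0 0.

Definition is_argmin (R : realType) (f : param R -> R) (J : set (param R))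
    (psi : param R) : Prop :=
  J psi /\ forall psi', J psi' -> f psi <= f psi'.

Definition box (R : realType) (atheta btheta : R) (asig bsig : 'I_2 -> R)
    (arho brho : R) : set (param R) :=
  [set psi | [/\ theta psi \in `[atheta, btheta],
                 (forall i, sigsq psi i \in `[asig i, bsig i]) &
                 rho psi \in `[arho, brho]]].

(* Main.v *)
Require Import Defs.
From mathcomp Require Import all_boot all_order all_algebra.
From mathcomp Require Import mxtens.
From mathcomp Require Import all_classical all_reals all_analysis.
From mathcomp Require Import measurable_realfun normal_distribution ring lra.

Import Order.TTheory GRing.Theory Num.Theory.
Import numFieldNormedType.Exports.

Local Open Scope classical_set_scope.
Local Open Scope ring_scope.

(** The process is Markov, so passing to the innovations
    [x k - e^(-theta (t k - t (k-1))) x (k-1)] diagonalizes the correlation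
    matrix, and regressing the second component on the first diagonalizes the
    2x2 factor. With [c k = 1 - e^(-2 theta (t k - t (k-1)))] the likelihood is
    thus an explicit sum over [k] of [ln c k] terms and of squares of innovations
    divided by [c k].

    Under the true parameter the innovations divided by [sqrt (c k)] form, for
    each n, an i.i.d. Gaussian array. As the designs for different n are
    unrelated, the strong law is obtained from fourth moments and
    Borel-Cantelli. The Gaussian hypothesis only gives the moment generating
    function of linear combinations, hence the moments of exponentials
    [e^(b W)]; the convergence of the empirical second moments follows from
    that of the empirical means of [e^(b W)], because
    [(e^(b x) + e^(- b x) - 2) / b^2] is close to [x^2] for small [b].

    Replacing [theta] by another value multiplies [c k] by the ratio of the two
    values up to a factor [1 + O(t k - t (k-1))] and changes the innovation by
    [O(t k - t (k-1)) x (k-1)]. The sum of the gaps being at most 1, these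
    errors are [o(n)] almost surely and uniformly on the box. Hence the excess of
    the likelihood at the minimizer, divided by n, bounds up to [o(1)] a
    Kullback-Leibler divergence between two bivariate Gaussian laws that only
    involves [theta sigma_1^2], [theta sigma_2^2] and [rho]; this divergence tends
    to 0, and it controls these three quantities. *)

Set Implicit Arguments.
Unset Strict Implicit.
Unset Printing Implicit Defensive.

(** * Almost sure convergence from summable means *)

Section mean.
Context d (T : measurableType d) (R : realType) (P : probability T R).
Implicit Types (f g : T -> R) (a b c : R).

(** Integrability and a finite real value are bundled, so that means are added, scaled and compared
    in [R] instead of the extended reals. *)
Definition has_mean f a : Prop :=
  P.-integrable setT (EFin \o f) /\ (\int[P]_x (f x)%:E)%E = a%:E.

Lemma has_mean_measurable f a : has_mean f a -> measurable_fun setT f.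
Proof. by move=> [/measurable_int/measurable_EFinP]. Qed.

Lemma has_mean_unique f a b : has_mean f a -> has_mean f b -> a = b.
Proof. by move=> [_ fa] [_]; rewrite fa => -[]. Qed.

Lemma has_mean_eq f g a : f =1 g -> has_mean f a -> has_mean g a.
Proof. by move=> /funext ->. Qed.

Lemma has_mean_cst c : has_mean (fun=> c) c.
Proof.
split; last by rewrite integral_cst//= probability_setT mule1.
exact: finite_measure_integrable_cst.
Qed.

Lemma has_meanZ f a c : has_mean f a -> has_mean (fun w => c * f w) (c * a).
Proof.
move=> [fi fa]; split.
  by have := integrableZl measurableT c fi; apply: eq_integrable.
under eq_integral do rewrite EFinM.
by rewrite integralZl// fa.
Qed.

Lemma has_meanD f g a b :
  has_mean f a -> has_mean g b -> has_mean (fun w => f w + g w) (a + b).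
Proof.
move=> [fi fa] [gi gb]; split.
  by have := integrableD measurableT fi gi; apply: eq_integrable.
by rewrite -[LHS]/(\int[P]_x ((f x)%:E + (g x)%:E))%E integralD// fa gb.
Qed.

Lemma has_mean_sum (I : Type) (r : seq I) (p : pred I) (F : I -> T -> R)
    (a : I -> R) : (forall i, p i -> has_mean (F i) (a i)) ->
  has_mean (fun w => \sum_(i <- r | p i) F i w) (\sum_(i <- r | p i) a i).
Proof.
move=> Fa; elim: r => [|i r IH].
  by rewrite big_nil; under eq_fun do rewrite big_nil; exact: has_mean_cst.
rewrite big_cons; under eq_fun do rewrite big_cons.
by case: ifP => // pi; apply: has_meanD => //; exact: Fa.
Qed.

Lemma has_mean_le f g a b : (forall w, f w <= g w) ->
  has_mean f a -> has_mean g b -> a <= b.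
Proof.
move=> fg [fi fa] [gi gb]; rewrite -lee_fin -fa -gb.
by apply: le_integral => // w _; rewrite lee_fin.
Qed.

Lemma has_mean_dominated f g b : measurable_fun setT f ->
  (forall w, `|f w| <= g w) -> has_mean g b -> {a | has_mean f a}.
Proof.
move=> mf fg [gi _].
have fi : P.-integrable setT (EFin \o f).
  apply: (le_integrable _ _ _ gi) => //; first exact/measurable_EFinP.
  by move=> w _ /=; rewrite lee_fin (le_trans (fg w))// ler_norm.
exists (fine (\int[P]_x (f x)%:E)); split => //.
by rewrite fineK//; exact: integrable_fin_num.
Qed.

End mean.

(** * Borel-Cantelli in mean form *)

Section borel_cantelli.
Context d (T : measurableType d) (R : realType) (P : probability T R).

Lemma sum_inv_sqr_le2 n : \sum_(0 <= k < n) (k.+1%:R ^- 2 : R) <= 2.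
Proof.
(* The induction needs this sharper bound: its increments [2 / ((n + 1) (n + 2))] dominate
   [1 / (n + 1) ^ 2]. *)
suff : \sum_(0 <= k < n) (k.+1%:R ^- 2 : R) <= 2 - 2 * n.+1%:R^-1.
  by move=> /le_trans; apply; rewrite gerBl.
elim: n => [|n IH]; first by rewrite big_geq// invr1; lra.
rewrite big_nat_recr//= (le_trans (lerD IH (lexx _)))//.
set x : R := n.+1%:R; have x1 : 1 <= x by rewrite ler1n.
have -> : n.+2%:R = x + 1 :> R by rewrite -[in LHS]addn1 natrD.
rewrite -subr_ge0.
have -> : 2 - 2 * (x + 1)^-1 - (2 - 2 * x^-1 + x ^- 2)
    = (x - 1) / (x ^+ 2 * (x + 1)).
  by field; apply/andP; split; rewrite gt_eqF//; lra.
by apply: divr_ge0; [lra|apply: mulr_ge0; [exact: sqr_ge0|lra]].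
Qed.

(** The means are summable, so the series of the nonnegative [g n] has a finite mean. It is
    therefore almost surely finite, and its terms tend to 0. *)
Lemma ae_cvg0_of_mean (g : nat -> T -> R) (m : nat -> R) (C : R) :
  (forall n w, 0 <= g n w) -> (forall n, has_mean P (g n) (m n)) ->
  (forall n, m n <= C / n.+1%:R ^+ 2) ->
  {ae P, forall w, g n w @[n --> \oo] --> 0}.
Proof.
move=> g0 gm mC.
have C0 : 0 <= C.
  have := mC 0; rewrite expr1n divr1; apply: le_trans.
  by apply: (has_mean_le _ (has_mean_cst P 0) (gm 0)) => w; exact: g0.
have mg n : measurable_fun setT (EFin \o g n).
  exact/measurable_EFinP/(has_mean_measurable (gm n)).
have gE0 n w : (0 <= (g n w)%:E)%E by rewrite lee_fin.
pose S w := (\sum_(n <oo) (g n w)%:E)%E.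
have mS : measurable_fun setT S.
  apply: ge0_emeasurable_sum => [n w _ _|n _]; [exact: gE0|exact: mg].
have iS : P.-integrable setT S.
  apply/integrableP; split => //.
  have SE w : (`|S w| = S w)%E.
    by rewrite gee0_abs//; apply: nneseries_ge0 => *; exact: gE0.
  under eq_integral do rewrite SE.
  rewrite integral_nneseries//.
  apply: (@le_lt_trans _ _ (C * 2)%:E); last by rewrite ltry.
  apply: lime_le.
    by apply: is_cvg_nneseries => n _ _; apply: integral_ge0.
  apply: nearW => n /=.
  under eq_bigr do rewrite (gm _).2.
  rewrite sumEFin lee_fin (@le_trans _ _ (\sum_(0 <= k < n) C * k.+1%:R ^- 2))//.
    by apply: ler_sum => k _; exact: mC.
  by rewrite -mulr_sumr ler_wpM2l// sum_inv_sqr_le2.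
have := integrable_ae measurableT iS.
apply: filterS => w /(_ I) Sfin.
apply: cvg_series_cvg_0.
apply: nnseries_is_cvg => //.
move: Sfin; rewrite ge0_fin_numE//.
by apply: nneseries_ge0 => *; exact: gE0.
Qed.

End borel_cantelli.

(** * Moments of Gaussian vectors *)

Section exponential_bounds.
Context (R : realType).
Implicit Types x y e : R.

Lemma expR_sub1_le y : expR y - 1 <= y * expR y.
Proof.
have := expR_ge1Dx (- y); rewrite -(ler_pM2r (expR_gt0 y)).
rewrite -expRD addNr expR0; lra.
Qed.

Lemma expR_norm_le y : expR `|y| <= expR y + expR (- y).
Proof.
have h1 := expR_ge0 y; have h2 := expR_ge0 (- y).
by case: (ger0P y) => _; lra.
Qed.

(** The bound [u <= expR u] at [u = y / n.+1], raised to the power [n.+1]. *)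
Lemma exprn_le_expR y n : 0 <= y -> y ^+ n.+1 <= n.+1%:R ^+ n.+1 * expR y.
Proof.
move=> y0; set k : R := n.+1%:R; have k0 : 0 < k by rewrite ltr0n.
have h : y <= k * expR (y / k).
  rewrite mulrC -ler_pdivrMr// (le_trans _ (expR_ge1Dx _))//.
  by rewrite lerDr.
have -> : k ^+ n.+1 * expR y = (k * expR (y / k)) ^+ n.+1.
  rewrite exprMn -expRM_natl; congr (_ * expR _).
  by rewrite mulrC divfK// gt_eqF.
by apply: lerXn2r; rewrite ?nnegrE// mulr_ge0 ?(ltW k0)// expR_ge0.
Qed.

Lemma expR_taylor1_bound y : 0 <= expR y - 1 - y <= y ^+ 2 * expR `|y|.
Proof.
apply/andP; split; first by have := expR_ge1Dx y; lra.
have h := expR_sub1_le y; have h1 := expR_ge1Dx y.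
have [y0|y0] := ger0P y.
  apply: (@le_trans _ _ (y * (expR y - 1))); first by lra.
  by rewrite expr2 -mulrA ler_wpM2l.
apply: (@le_trans _ _ (y * (expR y - 1))); first by lra.
rewrite expr2 -mulrA ler_wnM2l//; first lra.
have h2 : 1 <= expR (- y) by rewrite -expR0 ler_expR; lra.
have : y * expR (- y) <= y by rewrite ger_nMr.
lra.
Qed.

(** The left-hand expression [expR y + expR (- y) - 2] is the square of
    [s = expR (y / 2) - expR (- y / 2)], and for [y >= 0] the bound [1 + u <= expR u] alone places
    [s] between [y * expR (- y / 2)] and [y * expR (y / 2)]. *)
Lemma cosh_taylor2_bound y :
  `|expR y + expR (- y) - 2 - y ^+ 2| <= `|y| ^+ 3 * expR `|y|.
Proof.
wlog y0 : y / 0 <= y => [hw|].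
  have [y0|/ltW y0] := leP 0 y; first exact: hw.
  have := hw (- y); rewrite opprK sqrrN normrN (addrC (expR _)); apply.
  by rewrite oppr_ge0.
rewrite (ger0_norm y0).
set u := y / 2.
have u0 : 0 <= u by rewrite divr_ge0.
have yE : y = u + u by rewrite /u; field.
set s := expR u - expR (- u).
have eN : expR u * expR (- u) = 1 by rewrite -expRD subrr expR0.
have sE : expR y + expR (- y) - 2 = s ^+ 2.
  rewrite yE opprD !expRD /s; ring: eN.
have a0 := expR_gt0 u; have b0 := expR_gt0 (- u).
have hu : s <= y * expR u.
  have := expR_sub1_le (u + u); rewrite expRD.
  rewrite -(ler_pM2r b0) /s.
  have -> : (expR u * expR u - 1) * expR (- u) = expR u - expR (- u) by ring: eN.
  have -> : (u + u) * (expR u * expR u) * expR (- u) = y * expR u.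
    rewrite yE; ring: eN.
  by [].
have hl : y * expR (- u) <= s.
  have := expR_ge1Dx (u + u); rewrite expRD -(ler_pM2r b0) /s.
  have -> : expR u * expR u * expR (- u) = expR u by ring: eN.
  rewrite yE; lra.
have s0 : 0 <= s by apply: le_trans hl; rewrite mulr_ge0// ltW.
have ub : s ^+ 2 <= y ^+ 2 * expR y.
  rewrite [in expR y]yE expRD -expr2 -exprMn.
  by apply: lerXn2r; rewrite ?nnegrE// mulr_ge0// ltW.
have lb : y ^+ 2 * expR (- y) <= s ^+ 2.
  rewrite [in expR _]yE opprD expRD -expr2 -exprMn.
  by apply: lerXn2r; rewrite ?nnegrE// mulr_ge0// ltW.
have y20 := sqr_ge0 y.
rewrite sE ler_norml; apply/andP; split.
  have h3 : y ^+ 2 * (1 - y) <= y ^+ 2 * expR (- y).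
    by rewrite ler_wpM2l//; have := expR_ge1Dx (- y).
  have h4 : y ^+ 3 <= y ^+ 3 * expR y.
    by rewrite ler_peMr ?exprn_ge0// -expR0 ler_expR.
  have h5 : y ^+ 2 * (1 - y) = y ^+ 2 - y ^+ 3 by ring.
  lra.
have h3 : y ^+ 2 * (expR y - 1) <= y ^+ 2 * (y * expR y).
  by rewrite ler_wpM2l// expR_sub1_le.
have h4 : y ^+ 2 * (y * expR y) = y ^+ 3 * expR y by ring.
lra.
Qed.

(** Squares are recovered from exponentials with an error of order [e] times an envelope that has a
    finite Gaussian mean. The constant is [3 ^ 3], from [exprn_le_expR] with cubes. *)
Lemma second_difference_expR e x : 0 < e <= 1 ->
  `|(expR (e * x) + expR (- e * x) - 2) / e ^+ 2 - x ^+ 2|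
    <= 27 * e * (expR (2 * x) + expR (- 2 * x)).
Proof.
move=> /andP[e0 e1].
have e20 : 0 < e ^+ 2 by rewrite exprn_gt0.
have -> : (expR (e * x) + expR (- e * x) - 2) / e ^+ 2 - x ^+ 2
   = (expR (e * x) + expR (- (e * x)) - 2 - (e * x) ^+ 2) / e ^+ 2.
  by rewrite mulNr; field; rewrite gt_eqF.
rewrite normrM normfV (gtr0_norm e20) ler_pdivrMr//.
apply: (le_trans (cosh_taylor2_bound _)).
rewrite normrM (gtr0_norm e0) exprMn.
have hx := normr_ge0 x.
have h1 : expR (e * `|x|) <= expR `|x| by rewrite ler_expR ler_piMl.
have h2 : `|x| ^+ 3 <= 27 * expR `|x|.
  by rewrite (_ : 27 = 3%:R ^+ 3); [exact: exprn_le_expR|ring].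
have h3 : `|x| ^+ 3 * expR (e * `|x|) <= 27 * expR `|x| * expR `|x|.
  by apply: ler_pM => //; rewrite ?exprn_ge0 ?expR_ge0.
have h4 : expR `|x| * expR `|x| <= expR (2 * x) + expR (- 2 * x).
  rewrite -expRD (_ : `|x| + `|x| = `|2 * x|); last first.
    by rewrite normrM ger0_norm//; ring.
  by rewrite mulNr; exact: expR_norm_le.
have h5 : e ^+ 3 * (`|x| ^+ 3 * expR (e * `|x|))
    <= e ^+ 3 * (27 * (expR (2 * x) + expR (- 2 * x))).
  by rewrite ler_wpM2l ?exprn_ge0 ?(ltW e0)//; lra.
by apply: le_trans (le_trans h5 _); rewrite ?mulrA// le_eqVlt; apply/orP; left;
  apply/eqP; ring.
Qed.

(** The counterpart for [t |-> expR (v * t ^ 2 / 2)], the moment generating function of a centered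
    Gaussian law: the same second difference returns the variance [v] up to order [e]. *)
Lemma second_difference_expR_sqr e v : 0 < e <= 1 -> 0 <= v ->
  `|(expR (v * e ^+ 2 / 2) + expR (v * (- e) ^+ 2 / 2) - 2) / e ^+ 2 - v|
    <= e * (v ^+ 2 * expR v).
Proof.
move=> /andP[e0 e1] v0.
set u := v * e ^+ 2 / 2.
have e20 : 0 < e ^+ 2 by rewrite exprn_gt0.
have e2e : e ^+ 2 <= e by rewrite expr2 ger_pMr.
have u0 : 0 <= u by rewrite divr_ge0// mulr_ge0// ltW.
have ve : v * e ^+ 2 <= v by rewrite ler_piMr//; lra.
have uv : u <= v by rewrite /u; lra.
have -> : (expR u + expR (v * (- e) ^+ 2 / 2) - 2) / e ^+ 2 - v
    = (2 * (expR u - 1 - u)) / e ^+ 2.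
  by rewrite sqrrN -/u /u; field; rewrite gt_eqF.
have /andP[l0 l1] := expR_taylor1_bound u.
rewrite ger0_norm ?divr_ge0 ?(ltW e20) ?mulr_ge0// ler_pdivrMr//.
rewrite (ger0_norm u0) in l1.
have h1 : u ^+ 2 * expR u <= u ^+ 2 * expR v.
  by rewrite ler_wpM2l ?sqr_ge0// ler_expR.
have h2 : u ^+ 2 = e ^+ 2 * (e ^+ 2 * (v ^+ 2 / 4)) by rewrite /u; field.
have w0 : 0 <= v ^+ 2 * expR v by rewrite mulr_ge0 ?sqr_ge0 ?expR_ge0.
have h3 : e ^+ 2 * (v ^+ 2 * expR v) <= e * (v ^+ 2 * expR v).
  by rewrite ler_wpM2r.
have h4 : (e ^+ 2 * (v ^+ 2 * expR v)) * e ^+ 2 <=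
    (e * (v ^+ 2 * expR v)) * e ^+ 2 by rewrite ler_wpM2r// ltW.
have h5 : 0 <= e * (v ^+ 2 * expR v) * e ^+ 2.
  by rewrite mulr_ge0 ?(ltW e20)// mulr_ge0// ltW.
have h6 : u ^+ 2 * expR v = (e ^+ 2 * (v ^+ 2 * expR v)) * e ^+ 2 / 4.
  by rewrite h2; field.
lra.
Qed.

End exponential_bounds.

(** * Moment generating function of a Gaussian variable *)

Section gaussian_mgf.
Context (R : realType).

Lemma measurable_expRZ d (T : measurableType d) (X : T -> R) (t : R) :
  measurable_fun setT X -> measurable_fun setT (fun w => expR (t * X w)).
Proof.
move=> mX; apply: (measurableT_comp (@measurable_expR R)).
exact: (measurable_funM (measurable_cst t) mX).
Qed.

(** The density agrees almost everywhere with the Radon-Nikodym derivative, since both have the same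
    integral over every measurable set. *)
Lemma ge0_integral_normal_prob (m s : R) (f : R -> \bar R) :
  measurable_fun setT f -> (forall x, 0 <= f x)%E ->
  (\int[normal_prob m s]_x f x =
   \int[lebesgue_measure]_x (f x * (normal_pdf m s x)%:E))%E.
Proof.
move=> mf f0.
have numu := normal_prob_dominates m s.
rewrite -(Radon_Nikodym_SigmaFinite.change_of_variables numu)//.
have mpdf : measurable_fun setT (EFin \o normal_pdf m s).
  by apply/measurable_EFinP; exact: measurable_normal_pdf.
have ifr := Radon_Nikodym_SigmaFinite.f_integrable numu.
apply: ae_eq_integral => //.
- by apply: emeasurable_funM => //; exact: (measurable_int _ ifr).
- exact: emeasurable_funM.
- apply: ae_eqe_mul2l; apply: integral_ae_eq => //= E _ mE.
  by rewrite -Radon_Nikodym_SigmaFinite.f_integral.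
Qed.

(* Tilting the density by [expR (t * x)] shifts its mean. *)
Lemma normal_mgf (m s t : R) : s != 0 ->
  (\int[normal_prob m s]_x (expR (t * x))%:E =
   (expR (t * m + t ^+ 2 * s ^+ 2 / 2))%:E)%E.
Proof.
move=> s0.
rewrite ge0_integral_normal_prob//; last first.
  apply/measurable_EFinP; exact: measurable_expRZ.
under eq_integral => x _.
  rewrite -EFinM (_ : _ * normal_pdf _ _ _ = expR (t * m + t ^+ 2 * s ^+ 2 / 2) *
      normal_pdf (m + t * s ^+ 2) s x).
    rewrite EFinM; over.
  rewrite !normal_pdfE//= /normal_fun [LHS]mulrCA [RHS]mulrCA; congr (_ * _).
  rewrite -[LHS]expRD -[RHS]expRD; congr expR.
  by field.
rewrite ge0_integralZl//.
- by rewrite integral_normal_pdf mule1.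
- by apply/measurable_EFinP; exact: measurable_normal_pdf.
- by move=> x _; rewrite lee_fin normal_pdf_ge0.
Qed.

Context d (T : measurableType d) (P : probability T R).

Lemma gaussian_rv_mgf (X : {RV P >-> R}) : gaussian_rv P X ->
  exists m v : R, 0 <= v /\
    forall t, has_mean P (fun w => expR (t * X w)) (expR (t * m + t ^+ 2 * v / 2)).
Proof.
move=> [m [s XP]]; exists m, (s ^+ 2); split => [|t]; first exact: sqr_ge0.
have mX : measurable_fun setT (fun w => expR (t * X w)).
  exact: measurable_expRZ.
have me : measurable_fun setT (fun x : R => (expR (t * x))%:E).
  apply/measurable_EFinP; exact: measurable_expRZ.
have intE : (\int[P]_w (expR (t * X w))%:E =
    (expR (t * m + t ^+ 2 * s ^+ 2 / 2))%:E)%E.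
  rewrite -[LHS]/(\int[P]_w ((fun x : R => (expR (t * x))%:E) \o X) w)%E.
  rewrite -ge0_integral_distribution//.
  (* The degenerate law is a Dirac mass, and the same formula holds for it with zero variance. *)
  have [s0|s0] := eqVneq s 0.
    rewrite (eq_measure_integral (\d_m)); last first.
      by move=> B mB _ ; rewrite [LHS]XP// s0 eqxx.
    rewrite integral_dirac//= diracT mul1e; congr (expR _)%:E.
    by rewrite s0; ring.
  rewrite -(normal_mgf m t s0).
  (* The identity, seen as a map from [measurableTypeR R] to [R], carries the normal law to the
     measurable space on which the distribution of [X] lives. *)
  pose idR : measurableTypeR R -> R := idfun.
  have mid : measurable_fun setT idR by exact: measurable_id.
  transitivity (\int[pushforward (normal_prob m s) idR]_x (expR (t * x))%:E)%E.
    apply: eq_measure_integral => B mB _.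
    by rewrite [LHS]XP// (negbTE s0).
  rewrite (ge0_integral_pushforward mid)//.
split => //; apply/integrableP; split; first exact/measurable_EFinP.
under eq_integral => w _ do rewrite gee0_abs ?lee_fin ?expR_ge0//.
by rewrite intE ltry.
Qed.

End gaussian_mgf.

(** * Exponential moments of the process *)

Section centered_gaussian.
Context (R : realType) d (T : measurableType d) (P : probability T R).

Lemma eq0_of_le_small (x C : R) : (forall e, 0 < e <= 1 -> `|x| <= e * C) -> x = 0.
Proof.
move=> h; apply/eqP; rewrite -normr_le0 leNgt; apply/negP => x0.
have C0 : 0 <= C by have := h 1; rewrite ltr01 lexx mul1r => /(_ isT); lra.
have := h (`|x| / (`|x| + C + 1) / 2).
have D0 : 0 < `|x| + C + 1 by lra.
set y := `|x| / (`|x| + C + 1).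
have y1 : y <= 1 by rewrite ler_pdivrMr//; lra.
have y0 : 0 < y by rewrite divr_gt0.
have yD : y * (`|x| + C + 1) = `|x| by rewrite divfK// gt_eqF.
have /[swap]/[apply] : 0 < y / 2 <= 1 by lra.
have : 0 <= y * `|x| by rewrite mulr_ge0// ltW.
have : 0 <= y * C by rewrite mulr_ge0// ltW.
lra.
Qed.

(** Exponential moments at 1 and -1 dominate all powers. The value of the mean is left unspecified
    here and identified later by uniqueness. *)
Lemma exp_mean_dominates (X : T -> R) (M : R -> R) n : measurable_fun setT X ->
  (forall t, has_mean P (fun w => expR (t * X w)) (M t)) ->
  {a | has_mean P (fun w => X w ^+ n.+1) a}.
Proof.
move=> mX XM.
apply: has_mean_dominated (has_meanZ (n.+1%:R ^+ n.+1)
  (has_meanD (XM 1) (XM (- 1)))).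
  exact: measurable_funX.
move=> w /=; rewrite mul1r mulN1r normrX (le_trans (exprn_le_expR _ _))//.
by rewrite ler_wpM2l ?exprn_ge0// expR_norm_le.
Qed.

(** Replaces differentiation under the integral: the mean of the second difference quotient is
    within [O(e)] of the second moment and, by the explicit formula, within [O(e)] of [v]. *)
Lemma second_moment_of_mgf (X : T -> R) (v : R) :
    measurable_fun setT X -> 0 <= v ->
  (forall t, has_mean P (fun w => expR (t * X w)) (expR (v * t ^+ 2 / 2))) ->
  has_mean P (fun w => X w ^+ 2) v.
Proof.
move=> mX v0 XM.
have [a ha] := exp_mean_dominates 1 mX XM.
suff -> : v = a by [].
pose K := expR (v * 2 ^+ 2 / 2) + expR (v * (- 2) ^+ 2 / 2).
apply/eqP; rewrite -subr_eq0; apply/eqP.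
apply: (@eq0_of_le_small _ (v ^+ 2 * expR v + 27 * K)) => e e01.
have /andP[e0 _] := e01.
pose D w := (expR (e * X w) + expR (- e * X w) - 2) / e ^+ 2.
pose b := (expR (v * e ^+ 2 / 2) + expR (v * (- e) ^+ 2 / 2) - 2) / e ^+ 2.
have hD : has_mean P D b.
  rewrite /b mulrC; apply: has_mean_eq (has_meanZ _ (has_meanD
    (has_meanD (XM e) (XM (- e))) (has_mean_cst P (- 2)))) => w.
  by rewrite /D mulrC.
have hK : has_mean P (fun w => 27 * e * (expR (2 * X w) + expR (- 2 * X w)))
    (27 * e * K) by apply: has_meanZ; apply: has_meanD; exact: XM.
have hDX : has_mean P (fun w => D w + -1 * X w ^+ 2) (b + -1 * a).
  by apply: has_meanD hD _; exact: has_meanZ.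
have hXD : has_mean P (fun w => X w ^+ 2 + -1 * D w) (a + -1 * b).
  by apply: has_meanD ha _; exact: has_meanZ.
have bnd w := second_difference_expR (X w) e01.
have h1 : b + -1 * a <= 27 * e * K.
  apply: has_mean_le hDX hK => w; have := bnd w.
  by rewrite ler_norml -/(D w) => /andP[]; lra.
have h2 : a + -1 * b <= 27 * e * K.
  apply: has_mean_le hXD hK => w; have := bnd w.
  by rewrite ler_norml -/(D w) => /andP[]; lra.
have := second_difference_expR_sqr e01 v0; rewrite -/b !ler_norml => /andP[].
by move=> h3 h4; apply/andP; split; lra.
Qed.

(** A Gaussian law is given with unknown parameters; the first two moments, which are what the
    covariance structure supplies, identify them. *)
Lemma centered_gaussian_mgf (X : {RV P >-> R}) (v : R) : gaussian_rv P X ->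
  has_mean P X 0 -> has_mean P (fun w => X w ^+ 2) v ->
  forall t, has_mean P (fun w => expR (t * X w)) (expR (v * t ^+ 2 / 2)).
Proof.
move=> /gaussian_rv_mgf[m [s [s0 XM]]] EX EX2.
(* By [1 + t X <= expR (t X)] the mean of the right-hand side is at least 1 for
   every [t], which forces [m = 0]. *)
have pos t : 0 <= t * m + t ^+ 2 * s / 2.
  rewrite -ler_expR expR0.
  suff: 1 + t * 0 <= expR (t * m + t ^+ 2 * s / 2) by rewrite mulr0 addr0.
  apply: (has_mean_le _ (has_meanD (has_mean_cst P 1) (has_meanZ t EX)) (XM t)).
  by move=> w; exact: expR_ge1Dx.
have m0 : m = 0.
  apply/eqP; rewrite -sqrf_eq0 eq_le sqr_ge0 andbT.
  have s1 : 0 < s + 1 by lra.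
  have := pos (- m / (s + 1)).
  have -> : - m / (s + 1) * m + (- m / (s + 1)) ^+ 2 * s / 2
     = - (m ^+ 2 * ((s + 2) / (2 * (s + 1) ^+ 2))).
    by field; rewrite gt_eqF.
  rewrite oppr_ge0 pmulr_lle0//.
  by apply: divr_gt0; [lra|rewrite mulr_gt0// exprn_gt0].
have XM' t : has_mean P (fun w => expR (t * X w)) (expR (s * t ^+ 2 / 2)).
  by have := XM t; rewrite m0 mulr0 add0r (mulrC s).
have mX : measurable_fun setT X by exact: measurable_funP.
suff -> : v = s by [].
exact: has_mean_unique EX2 (second_moment_of_mgf mX s0 XM').
Qed.

Lemma RV_sumE (m : nat) (F : 'I_m -> {RV P >-> R}) (c : 'I_m -> R) w :
  (\sum_(k < m) (c k *: F k) : {mfun T >-> R}) w = \sum_(k < m) c k * F k w.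
Proof.
exact: (big_morph (fun f : {mfun T >-> R} => f w) (fun f g => erefl) erefl).
Qed.

Section process.
Variables (Z : 'I_2 -> R -> {RV P >-> R}) (psi : param R).
Hypothesis hZ : has_law P psi Z.

Let gauss1 i t : t \in `[0, 1] -> exists m v : R, 0 <= v /\ forall u,
  has_mean P (fun w => expR (u * Z i t w)) (expR (u * m + u ^+ 2 * v / 2)).
Proof.
move=> t01; have [gZ _ _] := hZ.
have := gZ 1 (fun=> i) (fun=> t) (fun=> 1) (fun=> t01).
move=> /gaussian_rv_mgf[m [v [v0 H]]]; exists m, v; split => // u.
apply: has_mean_eq (H u) => w.
by rewrite RV_sumE big_ord1 mul1r.
Qed.

(** The expectation in [has_law] is only the value of an integral; integrability is drawn from the
    Gaussian marginals. *)
Lemma process_mean i t : t \in `[0, 1] -> has_mean P (Z i t) 0.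
Proof.
move=> t01; have [m [v [_ H]]] := gauss1 i t01.
have [_ /(_ _ _ t01) EZ _] := hZ.
have [a ha] := exp_mean_dominates 0 (measurable_funP (Z i t)) H.
have {}ha : has_mean P (Z i t) a by apply: has_mean_eq ha => w; rewrite expr1.
suff -> : 0 = a :> R by [].
have [_] := ha; have := EZ i; rewrite unlock => -> [].
by [].
Qed.

(** Integrability of the product follows from that of the two squares; the covariance, with zero
    means, then gives the value. *)
Lemma process_product_mean i j s t : s \in `[0, 1] -> t \in `[0, 1] ->
  has_mean P (fun w => Z i s w * Z j t w) (cross_cov psi i j s t).
Proof.
move=> s01 t01.
have [ms [vs [_ Hs]]] := gauss1 i s01; have [mt [vt [_ Ht]]] := gauss1 j t01.
have [a ha] := exp_mean_dominates 1 (measurable_funP (Z i s)) Hs.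
have [b hb] := exp_mean_dominates 1 (measurable_funP (Z j t)) Ht.
have [c hc] : {c | has_mean P (fun w => Z i s w * Z j t w) c}.
  apply: has_mean_dominated (has_meanD ha hb) => [|w].
    exact: measurable_funM.
  rewrite normrM -(real_normK (num_real (Z i s w))).
  rewrite -(real_normK (num_real (Z j t w))).
  have := sqr_ge0 (`|Z i s w| - `|Z j t w|).
  have := sqr_ge0 (`|Z i s w|); have := sqr_ge0 (`|Z j t w|).
  rewrite sqrrB; lra.
suff -> : cross_cov psi i j s t = c by [].
have [_ EZ /(_ i j s t s01 t01)] := hZ.
have [_ hcE] := hc.
suff -> : covariance P (Z i s) (Z j t) = c%:E by move=> [].
rewrite -hcE unlock !EZ// unlock; apply: eq_integral => w _.
by rewrite !fctE/= !subr0.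
Qed.

(** Stated over an arbitrary finite index type, so that it applies to combinations indexed by
    products; the enumeration of [I] brings it back to [gaussian_process]. *)
Lemma process_mgf (I : finType) (i : I -> 'I_2) (t c : I -> R) (v : R) :
    (forall q, t q \in `[0, 1]) ->
    has_mean P (fun w => (\sum_q c q * Z (i q) (t q) w) ^+ 2) v ->
  has_mean P (fun w => expR (\sum_q c q * Z (i q) (t q) w)) (expR (v / 2)).
Proof.
move=> t01 EX2; have [gZ _ _] := hZ.
pose e := @enum_val I predT.
have g := gZ #|I| (i \o e) (t \o e) (c \o e) (fun k => t01 (e k)).
pose X : {mfun T >-> R} := \sum_(k < #|I|) (c (e k) *: Z (i (e k)) (t (e k))).
have XE w : \sum_q c q * Z (i q) (t q) w = X w.
  rewrite RV_sumE (reindex e)//.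
  by apply: onW_bij; exact: enum_val_bij.
have EX : has_mean P X 0.
  apply: (has_mean_eq XE).
  have z0 : \sum_q c q * 0 = 0 :> R by rewrite big1// => q; rewrite mulr0.
  rewrite -[X in has_mean _ _ X]z0.
  apply: (has_mean_sum _ (F := fun q w => c q * Z (i q) (t q) w)) => q _.
  by apply: has_meanZ; exact: process_mean.
have EX2' : has_mean P (fun w => X w ^+ 2) v.
  by apply: has_mean_eq EX2 => w; rewrite XE.
have := centered_gaussian_mgf g EX EX2' 1.
rewrite expr1n mulr1; apply: has_mean_eq => w.
by rewrite XE mul1r.
Qed.

End process.
End centered_gaussian.

(** * Strong law for triangular Gaussian arrays *)

Section fourth_moment.
Context (R : realType) d (T : measurableType d) (P : probability T R).
Variables (n : nat) (W : 'I_n -> T -> R) (tau b : R).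
Hypothesis mW : forall k, measurable_fun setT (W k).
(** This joint moment generating function is that of independent centered Gaussian variables of
    variance [tau]; it is the form in which independence enters. *)
Hypothesis W_mgf : forall v : 'I_n -> R,
  has_mean P (fun w => expR (\sum_k v k * W k w))
    (expR (tau * (\sum_k v k ^+ 2) / 2)).

Let C := expR (tau * b ^+ 2 / 2).
Let D k w := expR (b * W k w) - C.
Let dl (c : R) (k l : 'I_n) := if l == k then c else 0.

Let sum_dl c k (F : 'I_n -> R) : \sum_l dl c k l * F l = c * F k.
Proof.
rewrite (bigD1 k)//= /dl eqxx big1 ?addr0// => l /negbTE ->.
by rewrite mul0r.
Qed.

Let expW_mean c k :
  has_mean P (fun w => expR (c * W k w)) (expR (tau * c ^+ 2 / 2)).
Proof.
have := W_mgf (dl c k).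
have -> : \sum_l dl c k l ^+ 2 = c ^+ 2.
  under eq_bigr do rewrite expr2.
  by rewrite sum_dl /dl eqxx.
by apply: has_mean_eq => w; rewrite sum_dl.
Qed.

Let mD k : measurable_fun setT (D k).
Proof. by apply: measurable_funB => //; exact: measurable_expRZ. Qed.

(** The exponential weight in the coordinates other than [k] expresses that [D k] is centered
    independently of them. It makes the property stable under multiplication by another [D l],
    itself an exponential minus a constant. *)
Let centered k f := forall u : 'I_n -> R, u k = 0 ->
  has_mean P (fun w => D k w * expR (\sum_l u l * W l w) * f w) 0.

(** Since [u k = 0], adding [b] at coordinate [k] adds [b ^ 2] to the sum of squares, so the mean
    factors and the constant [C] cancels it. *)
Let centered1 k : centered k (fun=> 1).
Proof.
move=> u uk.
have sq : \sum_l (u l + dl b k l) ^+ 2 = \sum_l u l ^+ 2 + b ^+ 2.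
  rewrite (bigD1 k)//= [in RHS](bigD1 k)//= uk /dl eqxx add0r expr0n/= add0r.
  by rewrite addrC; congr (_ + _); apply: eq_bigr => l /negbTE ->; rewrite addr0.
have H := has_meanD (W_mgf (fun l => u l + dl b k l)) (has_meanZ (- C) (W_mgf u)).
have e0 : expR (tau * (\sum_l (u l + dl b k l) ^+ 2) / 2)
    + - C * expR (tau * (\sum_l u l ^+ 2) / 2) = 0.
  by rewrite sq /C mulrDr mulrDl expRD; ring.
rewrite e0 in H; apply: has_mean_eq H => w.
rewrite (eq_bigr (fun l => u l * W l w + dl b k l * W l w)); last first.
  by move=> l _; rewrite mulrDl.
by rewrite big_split/= sum_dl expRD /D; ring.
Qed.

Let centeredM k l f : l != k -> centered k f -> centered k (fun w => f w * D l w).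
Proof.
move=> lk cf u uk.
have uk' : u k + dl b l k = 0 by rewrite uk /dl eq_sym (negbTE lk) addr0.
have H := has_meanD (cf (fun i => u i + dl b l i) uk') (has_meanZ (- C) (cf _ uk)).
rewrite mulr0 addr0 in H; apply: has_mean_eq H => w.
rewrite (eq_bigr (fun i => u i * W i w + dl b l i * W i w)); last first.
  by move=> i _; rewrite mulrDl.
by rewrite big_split/= sum_dl expRD -[D l w]/(expR (b * W l w) - C); ring.
Qed.

(* A product of four centered terms has mean 0 as soon as one index is isolated,
   so only the O(n^2) index patterns made of two pairs contribute. *)
Let prod4_mean0 k1 k2 k3 k4 : k2 != k1 -> k3 != k1 -> k4 != k1 ->
  has_mean P (fun w => D k1 w * (D k2 w * (D k3 w * D k4 w))) 0.
Proof.
move=> h2 h3 h4.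
have := centeredM h4 (centeredM h3 (centeredM h2 (@centered1 k1))) (erefl 0).
apply: has_mean_eq => w; rewrite big1 => [|l _]; last by rewrite mul0r.
by rewrite expR0; ring.
Qed.

Let M := 8 * (expR (tau * (4 * b) ^+ 2 / 2) + C ^+ 4).

Let M_ge0 : 0 <= M.
Proof. by rewrite mulr_ge0// addr_ge0 ?exprn_ge0 ?expR_ge0. Qed.

(** The product is at most a quarter of the sum of the four fourth powers, and
    [(x + C) ^ 4 <= 8 (x ^ 4 + C ^ 4)] bounds each of these by exponentials. *)
Let prod4_bounded k1 k2 k3 k4 : exists2 c,
  has_mean P (fun w => D k1 w * (D k2 w * (D k3 w * D k4 w))) c & c <= M.
Proof.
pose h k w := 2 * (expR (4 * b * W k w) + C ^+ 4).
have hm k : has_mean P (h k) (2 * (expR (tau * (4 * b) ^+ 2 / 2) + C ^+ 4)).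
  by apply: has_meanZ; apply: has_meanD; [exact: expW_mean|exact: has_mean_cst].
have D4 k w : `|D k w| ^+ 4 <= 4 * h k w.
  rewrite /h (_ : 4 * b * W k w = 4%:R * (b * W k w)); last by ring.
  rewrite expRM_natl /D.
  set x := expR _; have x0 : 0 <= x by exact: expR_ge0.
  have C0 : 0 <= C by exact: expR_ge0.
  have : `|x - C| ^+ 4 <= (x + C) ^+ 4.
    apply: lerXn2r; rewrite ?nnegrE ?addr_ge0//.
    by rewrite ler_norml; apply/andP; split; lra.
  have : (x + C) ^+ 4 <= 8 * (x ^+ 4 + C ^+ 4).
    rewrite -subr_ge0.
    have -> : 8 * (x ^+ 4 + C ^+ 4) - (x + C) ^+ 4
      = (x - C) ^+ 2 * (7 * (x + C) ^+ 2 - 4 * x * C) by ring.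
    apply: mulr_ge0; first exact: sqr_ge0.
    have -> : 7 * (x + C) ^+ 2 - 4 * x * C = 5 * (x + C) ^+ 2 + 2 * (x ^+ 2 + C ^+ 2).
      by ring.
    by apply: addr_ge0; apply: mulr_ge0 => //; rewrite ?addr_ge0// sqr_ge0.
  lra.
have amgm (p q r s : R) : 4 * (p * (q * (r * s))) <= p ^+ 4 + q ^+ 4 + r ^+ 4 + s ^+ 4.
  rewrite -subr_ge0.
  have -> : p ^+ 4 + q ^+ 4 + r ^+ 4 + s ^+ 4 - 4 * (p * (q * (r * s)))
    = (p ^+ 2 - q ^+ 2) ^+ 2 + (r ^+ 2 - s ^+ 2) ^+ 2 + 2 * (p * q - r * s) ^+ 2.
    by ring.
  apply: addr_ge0; last by apply: mulr_ge0 => //; exact: sqr_ge0.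
  by apply: addr_ge0; exact: sqr_ge0.
have hM : has_mean P (fun w => h k1 w + h k2 w + h k3 w + h k4 w) M.
  pose a := 2 * (expR (tau * (4 * b) ^+ 2 / 2) + C ^+ 4).
  have -> : M = a + a + a + a by rewrite /M /a; ring.
  exact: has_meanD (has_meanD (has_meanD (hm k1) (hm k2)) (hm k3)) (hm k4).
have bnd w : `|D k1 w * (D k2 w * (D k3 w * D k4 w))|
    <= h k1 w + h k2 w + h k3 w + h k4 w.
  rewrite !normrM.
  have := amgm `|D k1 w| `|D k2 w| `|D k3 w| `|D k4 w|.
  have := D4 k1 w; have := D4 k2 w; have := D4 k3 w; have := D4 k4 w; lra.
have [c hc] : {c | has_mean P (fun w => D k1 w * (D k2 w * (D k3 w * D k4 w))) c}.
  by apply: has_mean_dominated hM => //; do 3 apply: measurable_funM => //.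
exists c => //; apply: has_mean_le hc hM => w.
exact: le_trans (ler_norm _) (bnd w).
Qed.

(** Counts the ways to match the four indices into two equal pairs. Each of the three matchings
    contributes [n ^ 2] to the total sum. *)
Let pairs (k1 k2 k3 k4 : 'I_n) : R :=
  (k1 == k2)%:R * (k3 == k4)%:R + (k1 == k3)%:R * (k2 == k4)%:R
  + (k1 == k4)%:R * (k2 == k3)%:R.

Let prod4_pairs k1 k2 k3 k4 : exists2 c,
  has_mean P (fun w => D k1 w * (D k2 w * (D k3 w * D k4 w))) c &
  c <= M * pairs k1 k2 k3 k4.
Proof.
have zero : (k2 != k1) && (k3 != k1) && (k4 != k1)
    || (k1 != k2) && (k3 != k2) && (k4 != k2)
    || (k1 != k3) && (k2 != k3) && (k4 != k3)
    || (k1 != k4) && (k2 != k4) && (k3 != k4) ->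
  has_mean P (fun w => D k1 w * (D k2 w * (D k3 w * D k4 w))) 0.
  case/orP => [/orP[/orP[]|]|] /andP[/andP[? ?] ?].
  - exact: prod4_mean0.
  - apply: (@has_mean_eq _ _ _ _ (fun w => D k2 w * (D k1 w * (D k3 w * D k4 w)))).
      by move=> w; ring.
    exact: prod4_mean0.
  - apply: (@has_mean_eq _ _ _ _ (fun w => D k3 w * (D k1 w * (D k2 w * D k4 w)))).
      by move=> w; ring.
    exact: prod4_mean0.
  - apply: (@has_mean_eq _ _ _ _ (fun w => D k4 w * (D k1 w * (D k2 w * D k3 w)))).
      by move=> w; ring.
    exact: prod4_mean0.
have p0 : 0 <= pairs k1 k2 k3 k4 by rewrite !addr_ge0// mulr_ge0.
have [p1|p1] := boolP [|| (k1 == k2) && (k3 == k4), (k1 == k3) && (k2 == k4)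
    | (k1 == k4) && (k2 == k3)].
  have [c hc cM] := prod4_bounded k1 k2 k3 k4; exists c => //.
  rewrite (le_trans cM)// ler_peMr// /pairs -!natrM -!natrD ler1n !mulnb.
  move: p1; do 3 case: (_ && _); by [].
exists 0; last by rewrite mulr_ge0.
apply: zero; move: p1; rewrite (eq_sym k2 k1) (eq_sym k3 k1) (eq_sym k4 k1).
rewrite (eq_sym k3 k2) (eq_sym k4 k2) (eq_sym k4 k3).
(* Transitivity of equality is recorded as boolean implications; the claim that some index is
   isolated is then checked over all truth values of the equalities. *)
have tr (x y z : 'I_n) : (x == y) ==> ((x == z) == (y == z)).
  by apply/implyP => /eqP ->.
have tr' (x y z : 'I_n) : (x == z) && (y == z) ==> (x == y).
  by apply/implyP => /andP[/eqP -> /eqP ->].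
move: (tr k1 k2 k3) (tr k1 k2 k4) (tr k1 k3 k4) (tr k2 k3 k4).
move: (tr' k1 k2 k3) (tr' k1 k2 k4) (tr' k1 k3 k4) (tr' k2 k3 k4).
case: (k1 == k2); case: (k1 == k3); case: (k1 == k4);
case: (k2 == k3); case: (k2 == k4); case: (k3 == k4); by [].
Qed.

Let sum_delta (k : 'I_n) : \sum_(l < n) (k == l)%:R = 1 :> R.
Proof.
rewrite (bigD1 k)//= eqxx big1 ?addr0// => l.
by rewrite eq_sym => /negbTE ->.
Qed.

Let sum_pairs : \sum_k1 \sum_k2 \sum_k3 \sum_k4 pairs k1 k2 k3 k4
  = 3 * n%:R ^+ 2.
Proof.
under eq_bigr => k1 _ do under eq_bigr => k2 _ do under eq_bigr => k3 _ do
  rewrite !big_split/= -!mulr_sumr !sum_delta !mulr1 -mulr_suml sum_delta mul1r.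
under eq_bigr => k1 _ do under eq_bigr => k2 _ do
  rewrite !big_split/= !sum_delta sumr_const card_ord -[_ *+ n]mulr_natl.
under eq_bigr => k1 _ do
  rewrite !big_split/= -mulr_sumr sum_delta !sumr_const card_ord.
by rewrite !big_split/= !sumr_const card_ord mulr1 -!mulrnA natrM; ring.
Qed.

(** The fourth power is expanded into a quadruple sum. The order [n ^ 2], against the [n ^ 4] of the
    normalization, is what makes the means summable. *)
Lemma fourth_moment_exp_sum : exists2 c,
  has_mean P (fun w => (\sum_k (expR (b * W k w) - C)) ^+ 4) c &
  c <= 3 * M * n%:R ^+ 2.
Proof.
pose c k1 k2 k3 k4 := projT1 (cid2 (prod4_pairs k1 k2 k3 k4)).
have hc k1 k2 k3 k4 :
    has_mean P (fun w => D k1 w * (D k2 w * (D k3 w * D k4 w))) (c k1 k2 k3 k4).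
  by rewrite /c; case: cid2.
have cM k1 k2 k3 k4 : c k1 k2 k3 k4 <= M * pairs k1 k2 k3 k4.
  by rewrite /c; case: cid2.
exists (\sum_k1 \sum_k2 \sum_k3 \sum_k4 c k1 k2 k3 k4).
  apply: (@has_mean_eq _ _ _ _ (fun w => \sum_k1 \sum_k2 \sum_k3 \sum_k4
      D k1 w * (D k2 w * (D k3 w * D k4 w)))).
    move=> w.
    under eq_bigr => k1 _ do under eq_bigr => k2 _ do under eq_bigr => k3 _ do
      rewrite -!mulr_sumr.
    under eq_bigr => k1 _ do under eq_bigr => k2 _ do
      rewrite -!mulr_sumr -mulr_suml.
    under eq_bigr => k1 _ do rewrite -mulr_sumr -mulr_suml.
    by rewrite -mulr_suml !exprS expr0 mulr1.
  apply: (has_mean_sum _ (F := fun k1 w => \sum_k2 \sum_k3 \sum_k4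
      D k1 w * (D k2 w * (D k3 w * D k4 w)))) => k1 _.
  apply: (has_mean_sum _ (F := fun k2 w => \sum_k3 \sum_k4
      D k1 w * (D k2 w * (D k3 w * D k4 w)))) => k2 _.
  apply: (has_mean_sum _ (F := fun k3 w => \sum_k4
      D k1 w * (D k2 w * (D k3 w * D k4 w)))) => k3 _.
  apply: (has_mean_sum _ (F := fun k4 w =>
      D k1 w * (D k2 w * (D k3 w * D k4 w)))) => k4 _.
  exact: hc.
rewrite (_ : 3 * M * n%:R ^+ 2 = M * (3 * n%:R ^+ 2)); last by ring.
rewrite -sum_pairs mulr_sumr; apply: ler_sum => k1 _.
rewrite mulr_sumr; apply: ler_sum => k2 _.
rewrite mulr_sumr; apply: ler_sum => k3 _.
by rewrite mulr_sumr; apply: ler_sum => k4 _.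
Qed.

End fourth_moment.

(** * Empirical moments of triangular arrays *)

Section gaussian_array.
Context (R : realType) d (T : measurableType d) (P : probability T R).

Lemma cvg0_of_exprn (u : nat -> R) m :
  u n ^+ m.+1 @[n --> \oo] --> 0 -> u n @[n --> \oo] --> 0.
Proof.
move=> /cvgr0Pnorm_lt h; apply/cvgr0Pnorm_lt => e e0.
have := h _ (exprn_gt0 m.+1 e0); apply: filterS => n.
by rewrite normrX ltr_pXn2r// nnegrE// ltW.
Qed.

(** The argument of [second_moment_of_mgf] with empirical means instead of expectations. Convergence
    is asked only at [2] and [-2], for the envelope, and at [1 / m.+1] and its opposite, for the
    quotients: a countable set, compatible with almost sure statements. *)
Lemma second_moment_cvg_of_mgf (x : nat -> nat -> R) (tau : R) : 0 <= tau ->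
  (forall b, b \in [:: 2; - 2] \/ (exists m, `|b| = m.+1%:R^-1) ->
    n.+1%:R^-1 * \sum_(k < n.+1) expR (b * x n k) @[n --> \oo]
      --> expR (tau * b ^+ 2 / 2)) ->
  n.+1%:R^-1 * \sum_(k < n.+1) x n k ^+ 2 @[n --> \oo] --> tau.
Proof.
move=> tau0 h.
pose avg n (f : R -> R) := n.+1%:R^-1 * \sum_(k < n.+1) f (x n k).
have avg_le n f g : (forall y, f y <= g y) -> avg n f <= avg n g.
  by move=> fg; rewrite ler_wpM2l// ler_sum.
pose K := expR (tau * 2 ^+ 2 / 2) + expR (tau * (- 2) ^+ 2 / 2).
have K0 : 0 < K by rewrite addr_gt0// expR_gt0.
have hK : avg n (fun y => expR (2 * y) + expR (- 2 * y)) @[n --> \oo] --> K.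
  rewrite /avg; under eq_fun do rewrite big_split/= mulrDr.
  by apply: cvgD; apply: h; left; rewrite !inE eqxx ?orbT.
set L := tau ^+ 2 * expR tau; have L0 : 0 <= L.
  by rewrite mulr_ge0 ?sqr_ge0 ?expR_ge0.
apply/cvgrPdist_lt => eps eps0.
(* Collects the errors per unit of [e]: [L] from the Gaussian formula, [27 * (K + 1)] from the
   empirical envelope, eventually below [K + 1]. *)
pose Q := L + 27 * (K + 1) + 1.
have Q0 : 0 < Q by rewrite /Q; lra.
have [m mQ] : exists m, m.+1%:R^-1 * Q < eps / 2.
  exists (Num.truncn (2 * Q / eps)); rewrite mulrC ltr_pdivrMr//.
  have := Num.Theory.truncnS_gt (2 * Q / eps); rewrite ltr_pdivrMr//.
  set z := _%:R; lra.
set e : R := m.+1%:R^-1 in mQ.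
have e0 : 0 < e by rewrite invr_gt0.
have e01 : 0 < e <= 1 by rewrite e0/= invf_le1 ?ler1n.
pose D y := (expR (e * y) + expR (- e * y) - 2) / e ^+ 2.
pose b := (expR (tau * e ^+ 2 / 2) + expR (tau * (- e) ^+ 2 / 2) - 2) / e ^+ 2.
have hD : avg n D @[n --> \oo] --> b.
  have avgD n : avg n D = (avg n (fun y => expR (e * y))
      + avg n (fun y => expR (- e * y)) - 2) / e ^+ 2.
    rewrite /avg /D -mulr_suml !big_split/= sumr_const card_ord.
    rewrite -(mulr_natl (- 2)); have N0 : n.+1%:R != 0 :> R by rewrite pnatr_eq0.
    move: (n.+1%:R) N0 => N N0; field.
    by rewrite N0 gt_eqF.
  under eq_fun do rewrite avgD.
  apply: cvgMl; apply: cvgB; last exact: cvg_cst.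
  apply: cvgD; apply: h; right; exists m; rewrite ?normrN gtr0_norm//.
near=> n.
have nK : `|K - avg n (fun y => expR (2 * y) + expR (- 2 * y))| < 1.
  near: n; move/cvgrPdist_lt : hK; exact.
have nD : `|b - avg n D| < eps / 2.
  by near: n; move/cvgrPdist_lt : hD; apply; rewrite divr_gt0.
have bnd y := second_difference_expR y e01.
have avgDx (s : R) : avg n (fun y => s * D y - s * y ^+ 2) =
    s * avg n D - s * avg n (fun y => y ^+ 2).
  rewrite /avg big_split/= sumrN -!mulr_sumr; ring.
have avgE : avg n (fun y => 27 * e * (expR (2 * y) + expR (- 2 * y))) =
    27 * e * avg n (fun y => expR (2 * y) + expR (- 2 * y)).
  by rewrite /avg -mulr_sumr; ring.
have h1 : 1 * avg n D - 1 * avg n (fun y => y ^+ 2) <=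
    27 * e * avg n (fun y => expR (2 * y) + expR (- 2 * y)).
  rewrite -avgDx -avgE; apply: avg_le => y.
  by have := bnd y; rewrite -/(D y) ler_norml => /andP[]; lra.
have h2 : -1 * avg n D - -1 * avg n (fun y => y ^+ 2) <=
    27 * e * avg n (fun y => expR (2 * y) + expR (- 2 * y)).
  rewrite -avgDx -avgE; apply: avg_le => y.
  by have := bnd y; rewrite -/(D y) ler_norml => /andP[]; lra.
have h3 : 27 * e * avg n (fun y => expR (2 * y) + expR (- 2 * y))
    <= 27 * e * (K + 1).
  rewrite ler_wpM2l ?mulr_ge0 ?(ltW e0)//.
  by move: nK; rewrite ltr_norml => /andP[]; lra.
have := second_difference_expR_sqr e01 tau0; rewrite -/b -/L ler_norml => /andP[].
move: nD mQ; rewrite -/(avg n (fun y => y ^+ 2)) !ltr_norml /Q => /andP[].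
move=> ? ? ? ? ?; apply/andP; split; lra.
Unshelve. all: by end_near. Qed.

Section array.
Variables (W : nat -> nat -> T -> R) (tau : R).
Hypothesis tau0 : 0 <= tau.
Hypothesis mW : forall n k, measurable_fun setT (W n k).
Hypothesis W_mgf : forall n (v : 'I_n.+1 -> R),
  has_mean P (fun w => expR (\sum_(k < n.+1) v k * W n k w))
    (expR (tau * (\sum_k v k ^+ 2) / 2)).

Lemma ae_cvg_empirical_mgf b : {ae P, forall w,
  n.+1%:R^-1 * \sum_(k < n.+1) expR (b * W n k w) @[n --> \oo]
    --> expR (tau * b ^+ 2 / 2)}.
Proof.
pose C := expR (tau * b ^+ 2 / 2).
pose S n w := \sum_(k < n.+1) (expR (b * W n k w) - C).
pose M := 3 * (8 * (expR (tau * (4 * b) ^+ 2 / 2) + C ^+ 4)).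
have fm n : {c | has_mean P (fun w => S n w ^+ 4) c &
    c <= M * n.+1%:R ^+ 2}.
  apply: cid2; rewrite /M.
  exact: (@fourth_moment_exp_sum _ _ _ P n.+1 (fun k => W n k)).
pose g n w := (n.+1%:R^-1 * S n w) ^+ 4.
pose m n := n.+1%:R^-1 ^+ 4 * s2val (fm n).
have : {ae P, forall w, g n w @[n --> \oo] --> 0}.
  apply: (@ae_cvg0_of_mean _ _ _ _ g m M).
  - by move=> n w; rewrite exprn_even_ge0.
  - move=> n; apply: has_mean_eq (has_meanZ _ (s2valP (fm n))) => w.
    by rewrite /g exprMn.
  - move=> n; rewrite /m.
    apply: (@le_trans _ _ (n.+1%:R^-1 ^+ 4 * (M * n.+1%:R ^+ 2))).
      by rewrite ler_wpM2l ?exprn_ge0// (s2valP' (fm n)).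
    rewrite le_eqVlt; apply/orP; left; apply/eqP.
    have N0 : n.+1%:R != 0 :> R by rewrite pnatr_eq0.
    by move: (n.+1%:R) N0 => N N0; field.
apply: filterS => w /cvg0_of_exprn gw.
have : C + n.+1%:R^-1 * S n w @[n --> \oo] --> C + 0.
  by apply: cvgD => //; exact: cvg_cst.
rewrite addr0; apply: cvg_trans; apply: near_eq_cvg; apply: nearW => n.
rewrite /S big_split/= sumr_const card_ord -/C -(mulr_natl (- C)).
have N0 : n.+1%:R != 0 :> R by rewrite pnatr_eq0.
by move: (n.+1%:R) N0 => N N0; field.
Qed.

Lemma ae_cvg_empirical_second_moment : {ae P, forall w,
  n.+1%:R^-1 * \sum_(k < n.+1) W n k w ^+ 2 @[n --> \oo] --> tau}.
Proof.
have h m : {ae P, forall w,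
   (n.+1%:R^-1 * \sum_(k < n.+1) expR (m.+1%:R^-1 * W n k w) @[n --> \oo]
    --> expR (tau * m.+1%:R^-1 ^+ 2 / 2)) /\
   (n.+1%:R^-1 * \sum_(k < n.+1) expR (- m.+1%:R^-1 * W n k w) @[n --> \oo]
    --> expR (tau * (- m.+1%:R^-1) ^+ 2 / 2))}.
  apply: (filterS2 _ _ (ae_cvg_empirical_mgf m.+1%:R^-1)
    (ae_cvg_empirical_mgf (- m.+1%:R^-1))).
  by move=> w ? ?; split.
move/ae_foralln : h => h.
apply: (filterS3 _ _ h (ae_cvg_empirical_mgf 2) (ae_cvg_empirical_mgf (- 2))).
move=> w {}h h2 hN2; apply: (second_moment_cvg_of_mgf (x := fun n k => W n k w)) => // b [|[m]].
  by rewrite !inE => /orP[]/eqP ->.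
have [b0|b0] := ger0P b; first by move=> ->; exact: (h m).1.
move=> /eqP; rewrite eqr_oppLR => /eqP ->; exact: (h m).2.
Qed.

End array.

(** Cauchy-Schwarz for weights of total at most [S], from the nonnegativity of the weighted squared
    deviations around [t / S]. *)
Lemma weighted_square_sum_le n (delta a : 'I_n -> R) (S : R) : 0 < S ->
  (forall k, 0 <= delta k) -> \sum_k delta k <= S ->
  (\sum_k delta k * a k) ^+ 2 <= S * \sum_k delta k * a k ^+ 2.
Proof.
move=> S0 d0 dS; set t := \sum_k delta k * a k.
pose l := t / S; have tE : t = l * S by rewrite /l divfK// gt_eqF.
have : 0 <= \sum_k delta k * (a k - l) ^+ 2.
  by apply: sumr_ge0 => k _; rewrite mulr_ge0// sqr_ge0.
have -> : \sum_k delta k * (a k - l) ^+ 2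
    = \sum_k delta k * a k ^+ 2 - 2 * l * t + l ^+ 2 * \sum_k delta k.
  rewrite /t !mulr_sumr -sumrB -big_split/=; apply: eq_bigr => k _; ring.
have h1 : l ^+ 2 * \sum_k delta k <= l ^+ 2 * S by rewrite ler_wpM2l ?sqr_ge0.
have h2 : 2 * l * t = 2 * (l ^+ 2 * S) by rewrite tE; ring.
have h3 : t ^+ 2 = S * (l ^+ 2 * S) by rewrite tE; ring.
by move=> h4; rewrite h3 ler_wpM2l ?(ltW S0)//; lra.
Qed.

(** By Cauchy-Schwarz the squared weighted sum is at most [S] times a weighted sum of fourth powers.
    The mean of the latter is bounded because the total weight is, so the squared average has mean
    [O(1 / n ^ 2)]. *)
Lemma ae_cvg0_weighted_squares (X : nat -> nat -> T -> R)
    (delta : nat -> nat -> R) (S K : R) : 0 < S ->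
  (forall n k, measurable_fun setT (X n k)) ->
  (forall n k, (k <= n)%N -> exists2 m,
    has_mean P (fun w => expR (X n k w) + expR (- X n k w)) m & m <= K) ->
  (forall n k, (k <= n)%N -> 0 <= delta n k) ->
  (forall n, \sum_(k < n.+1) delta n k <= S) ->
  {ae P, forall w, n.+1%:R^-1 * \sum_(k < n.+1) delta n k * X n k w ^+ 2
    @[n --> \oo] --> 0}.
Proof.
move=> S0 mX XK d0 dS.
(* The constant of [exprn_le_expR] for fourth powers. *)
pose c : R := 4%:R ^+ 4; have c0 : 0 <= c by rewrite exprn_ge0.
have X4 n (k : 'I_n.+1) : {m | has_mean P (fun w => X n k w ^+ 4) m & m <= c * K}.
  apply: cid2; have [|m hm mK] := XK n k; first by rewrite -ltnS.
  have b w : `|X n k w ^+ 4| <= c * (expR (X n k w) + expR (- X n k w)).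
    rewrite normrX (le_trans (exprn_le_expR 3 (normr_ge0 _)))//.
    by rewrite ler_wpM2l ?expR_norm_le.
  have hm4 := has_meanZ c hm.
  have [|a ha] := has_mean_dominated _ b hm4; first exact: measurable_funX.
  exists a => //; apply: (@le_trans _ _ (c * m)); last by rewrite ler_wpM2l.
  by apply: has_mean_le ha hm4 => w; rewrite (le_trans _ (b w))// ler_norm.
pose Q n w := \sum_(k < n.+1) delta n k * X n k w ^+ 2.
pose U n w := S * \sum_(k < n.+1) delta n k * X n k w ^+ 4.
have d0' n (k : 'I_n.+1) : 0 <= delta n k by rewrite d0// -ltnS.
have QU n w : Q n w ^+ 2 <= U n w.
  rewrite /U; under eq_bigr do rewrite (_ : 4%N = (2 * 2)%N)// exprM.
  exact: weighted_square_sum_le.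
have hU n : has_mean P (U n) (S * \sum_(k < n.+1) delta n k * s2val (X4 n k)).
  apply: has_meanZ.
  apply: (has_mean_sum _ (F := fun (k : 'I_n.+1) w => delta n k * X n k w ^+ 4)) => k _.
  exact/has_meanZ/(s2valP (X4 n k)).
have K0 : 0 <= K.
  have [//|m hm mK] := XK 0%N 0%N; rewrite (le_trans _ mK)//.
  apply: has_mean_le (has_mean_cst P 0) hm => w.
  by rewrite addr_ge0// expR_ge0.
have UK n : S * \sum_(k < n.+1) delta n k * s2val (X4 n k) <= S * (c * K * S).
  rewrite ler_wpM2l ?(ltW S0)//.
  apply: (@le_trans _ _ (\sum_(k < n.+1) c * K * delta n k)).
    by apply: ler_sum => k _; rewrite mulrC ler_wpM2r// (s2valP' (X4 n k)).
  by rewrite -mulr_sumr ler_wpM2l// mulr_ge0.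
pose g n w := (n.+1%:R^-1) ^+ 2 * U n w.
pose m n := n.+1%:R^-1 ^+ 2 *
  (S * \sum_(k < n.+1) delta n k * s2val (X4 n k)).
have : {ae P, forall w, g n w @[n --> \oo] --> 0}.
  apply: (@ae_cvg0_of_mean _ _ _ _ g m (S * (c * K * S))).
  - by move=> n w; rewrite mulr_ge0 ?sqr_ge0// (le_trans _ (QU n w))// sqr_ge0.
  - by move=> n; apply: has_meanZ; exact: hU.
  - by move=> n; rewrite /m exprVn mulrC ler_wpM2r// invr_ge0 exprn_ge0.
apply: filterS => w gw; apply: (@cvg0_of_exprn _ 1).
apply: (squeeze_cvgr _ (cvg_cst 0) gw).
apply: nearW => n; rewrite sqr_ge0/= exprMn /g.
by rewrite ler_wpM2l ?sqr_ge0//; exact: QU.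
Qed.

End gaussian_array.

(** * Explicit form and minimum of the likelihood *)

Section congruence.
Context (R : fieldType).

(** With [M] of determinant 1 the determinant is unchanged by the congruence, and the inverse of [S]
    is [M^T *m diag_mx f *m M], where [f] holds the inverses of the entries of [e]. *)
Lemma congruence_diag_inv N (S M : 'M[R]_N) (e : 'rV[R]_N) (x : 'cV[R]_N) :
    M *m S *m M^T = diag_mx e -> (forall i, e 0 i != 0) -> \det M = 1 ->
  (\det S = \prod_i e 0 i) /\
  (x^T *m invmx S *m x) 0 0 = \sum_i (M *m x) i 0 ^+ 2 / e 0 i.
Proof.
move=> MSM e0 detM.
have detS : \det S = \prod_i e 0 i.
  by rewrite -det_diag -MSM !det_mulmx det_tr detM mul1r mulr1.
have uM : M \in unitmx by rewrite unitmxE detM unitr1.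
have uMT : M^T \in unitmx by rewrite unitmx_tr.
pose f : 'rV[R]_N := \row_i (e 0 i)^-1.
have ef : diag_mx e *m diag_mx f = 1%:M.
  apply/matrixP => i j; rewrite mul_diag_mx !mxE.
  by case: eqP => [->|_]; rewrite ?mulr0// mulr1n divff.
have SE : S = invmx M *m diag_mx e *m invmx M^T.
  by rewrite -MSM mulmxA mulKmx// mulmxK.
have SV : S *m (M^T *m diag_mx f *m M) = 1%:M.
  rewrite SE -!mulmxA (mulmxA (invmx M^T)) mulVmx// mul1mx (mulmxA (diag_mx e)).
  by rewrite ef mul1mx mulVmx.
have uS : S \in unitmx by rewrite unitmxE detS unitfE; apply/prodf_neq0.
have -> : invmx S = M^T *m diag_mx f *m M.
  by rewrite -[RHS](mulKmx uS) SV mulmx1.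
split=> //.
rewrite !mulmxA -trmx_mul -mulmxA mxE; apply: eq_bigr => i _.
by rewrite mul_mx_diag !mxE -/(M *m x) expr2 mulrAC.
Qed.

End congruence.

(** * Innovations for an exponential correlation *)

Section ornstein_uhlenbeck.
Context (R : realType).
Implicit Types (th : R) (t : nat -> R).

(* With [ar th t 0 = 0] the first innovation is the first observation, whatever
   the junk value [x 0.-1 = x 0] that it multiplies. *)
Definition ar th t k : R :=
  if k is k'.+1 then expR (- th * (t k'.+1 - t k')) else 0.
Definition innov th t (x : nat -> R) k : R := x k - ar th t k * x k.-1.
Definition innov_var th t k : R := 1 - ar th t k ^+ 2.
Definition ou th t k l : R := expR (- th * `|t k - t l|).

Lemma increasing_le t n i j : (forall i, (i < n)%N -> t i < t i.+1) ->
  (i <= j <= n)%N -> t i <= t j.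
Proof.
move=> tS; elim: j => [|j IH] /andP[]; first by rewrite leqn0 => /eqP ->.
rewrite leq_eqVlt => /predU1P[->//|ij] jn.
apply: (@le_trans _ _ (t j)); last by apply/ltW/tS.
by apply: IH; rewrite -ltnS ij ltnW.
Qed.

Lemma ouC th t k l : ou th t k l = ou th t l k.
Proof. by rewrite /ou distrC. Qed.

(** The Markov property for correlations: distances add up along increasing times, so exponentials
    multiply. *)
Lemma ou_markov th t k l : (forall i j, (i <= j <= k)%N -> t i <= t j) ->
  (l < k)%N -> ou th t k l = ar th t k * ou th t k.-1 l.
Proof.
case: k => // k tm; rewrite ltnS => lk /=.
rewrite /ou -expRD -mulrDr !ger0_norm ?subr_ge0 ?tm//; last 2 first.
  by rewrite lk leqnSn.
  by rewrite leqW//= leqnn.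
congr (expR (_ * _)); ring.
Qed.

(** The left-hand side is the correlation of the innovations [k] and [l], expanded bilinearly. For
    [l < k] it vanishes by [ou_markov], applied to both [l] and [l.-1]. *)
Lemma innov_decorrelated th t n k l :
    (forall i j, (i <= j <= n)%N -> t i <= t j) -> (k <= n)%N -> (l <= n)%N ->
  ou th t k l - ar th t k * ou th t k.-1 l
    - ar th t l * (ou th t k l.-1 - ar th t k * ou th t k.-1 l.-1)
  = (k == l)%:R * innov_var th t k.
Proof.
move=> tm.
have tm' k' : (k' <= n)%N -> forall i j, (i <= j <= k')%N -> t i <= t j.
  by move=> kn i j /andP[ij jk]; rewrite tm// ij (leq_trans jk).
wlog kl : k l / (l <= k)%N => [hw kn ln|].
  have [lk|/ltnW kl] := leqP l k; first exact: hw.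
  have := hw l k kl ln kn; rewrite eq_sym.
  rewrite !(ouC _ _ l) !(ouC _ _ l.-1) => E.
  have -> : (k == l)%:R * innov_var th t k = (k == l)%:R * innov_var th t l.
    by case: eqP => [->|_]; rewrite ?mul0r.
  rewrite -E; ring.
move=> kn ln; have [lk|kl'|kl'] := ltngtP l k.
- rewrite mul0r (ou_markov _ (tm' k kn) lk).
  case: l lk {kl ln} => [|l] lk; first by rewrite /=; ring.
  by rewrite /= (ou_markov _ (tm' k kn) (ltnW lk)); ring.
- by rewrite leqNgt kl' in kl.
rewrite kl' ?eqxx mul1r /innov_var.
have ou1 i : ou th t i i = 1 by rewrite /ou subrr normr0 mulr0 expR0.
case: k kn {kl kl' ln} => [|k] kn; first by rewrite /= ou1; ring.
rewrite !ou1 (ouC _ _ k.+1.-1) (ou_markov _ (tm' _ kn) (ltnSn k)) /= ou1; ring.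
Qed.

(** Unit lower bidiagonal, hence of determinant 1; it maps the observations to their innovations. *)
Definition innov_mx n th t : 'M[R]_n.+1 :=
  \matrix_(k, l) ((k == l)%:R - (l.+1 == k)%:R * ar th t k).

Lemma mul_innov_mx n th t p (X : 'M[R]_(n.+1, p)) k j :
  (innov_mx n th t *m X) k j = X k j - ar th t k * X (inord k.-1) j.
Proof.
rewrite mxE; under eq_bigr do rewrite mxE mulrBl.
rewrite sumrB; congr (_ - _).
  rewrite (bigD1 k)//= eqxx mul1r big1 ?addr0// => i /negbTE.
  by rewrite eq_sym => ->; rewrite mul0r.
rewrite (bigD1 (inord k.-1))//= inordK; last first.
  by rewrite (leq_ltn_trans (leq_pred k)).
rewrite big1 ?addr0 => [|i ik].
  by case: k => -[|k] kn/=; rewrite ?eqxx ?mul1r// !mul0r.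
case: eqP => [e|]; rewrite ?mul0r//; case/eqP: ik.
by apply/val_inj; rewrite /= -e /= inordK// ltnW// e.
Qed.

Lemma innov_mx_trig n th t : is_trig_mx (innov_mx n th t).
Proof.
apply/is_trig_mxP => i j ij; rewrite mxE.
rewrite (_ : (i == j) = false); last by apply/negbTE; rewrite neq_ltn ij.
by rewrite gtn_eqF ?mul0r ?subr0// ltnW.
Qed.

End ornstein_uhlenbeck.

(** * The likelihood as an explicit sum *)

Section likelihood.
Context (R : realType).
Implicit Types (psi : param R) (th : R) (t : nat -> R).

(* Regression of the second component on the first: [Amx psi] is congruent to
   diag(sigsq psi 0, cond_var psi) via the slope [cond_slope psi]. *)
Definition cond_slope psi : R := rho psi * sigma psi ord_max / sigma psi ord0.
Definition cond_var psi : R := sigsq psi ord_max * (1 - rho psi ^+ 2).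

(** The quadratic form of the inverse of a 2x2 covariance matrix, given by the first variance [d0],
    the slope [b] of the second component on the first and the residual variance [d1]. *)
Definition contrast (d0 d1 b y0 y1 : R) : R :=
  y0 ^+ 2 / d0 + (y1 - b * y0) ^+ 2 / d1.

(** The likelihood without its additive constant, in the regression coordinates [(th, d0, d1, b)],
    in which it is diagonal. *)
Definition nll_sum (n : nat) (t : nat -> R) (x : 'I_2 -> nat -> R)
    (th d0 d1 b : R) : R :=
  \sum_(k < n.+1) (ln d0 + ln d1 + 2 * ln (innov_var th t k)
    + contrast d0 d1 b (innov th t (x ord0) k) (innov th t (x ord_max) k)
      / innov_var th t k).

Lemma big_ord2 (S : Type) (idx : S) (op : Monoid.law idx) (F : 'I_2 -> S) :
  \big[op/idx]_i F i = op (F ord0) (F ord_max).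
Proof.
rewrite !big_ord_recl big_ord0 Monoid.mulm1; congr (op _ (F _)).
exact/val_inj.
Qed.

Lemma ord2P (i : 'I_2) : i = ord0 \/ i = ord_max.
Proof. by case: i => -[|[|//]] ?; [left|right]; exact/val_inj. Qed.

Lemma cond_var_gt0 psi : (forall i, 0 < sigsq psi i) -> -1 < rho psi < 1 ->
  0 < cond_var psi.
Proof.
move=> d0 /andP[r1 r2]; rewrite mulr_gt0// subr_gt0.
by rewrite -real_normK ?num_real// expr_lt1// ltr_norml r1.
Qed.

Lemma ar_lt1 th t n k : 0 < th -> (forall i, (i < n)%N -> t i < t i.+1) ->
  (k <= n)%N -> 0 <= ar th t k < 1.
Proof.
move=> th0 tS; case: k => [|k] kn /=; first by rewrite lexx ltr01.
rewrite expR_ge0/= -expR0 ltr_expR mulNr oppr_lt0 mulr_gt0// subr_gt0.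
exact: tS.
Qed.

Lemma innov_var_gt0 th t n k : 0 < th -> (forall i, (i < n)%N -> t i < t i.+1) ->
  (k <= n)%N -> 0 < innov_var th t k.
Proof.
move=> th0 tS kn; have /andP[a0 a1] := ar_lt1 th0 tS kn.
by rewrite subr_gt0 expr_lt1.
Qed.

Definition component_mx psi : 'M[R]_2 :=
  \matrix_(i, j) ((i == j)%:R
    - ((i == ord_max) && (j == ord0))%:R * cond_slope psi).

Lemma component_mx_congruence psi : (forall i, 0 < sigsq psi i) ->
  component_mx psi *m Amx psi *m (component_mx psi)^T
  = diag_mx (\row_i if i == ord0 then sigsq psi ord0 else cond_var psi).
Proof.
move=> d0.
have sg i : sigma psi i != 0 by rewrite gt_eqF// sqrtr_gt0.
have sq i : sigsq psi i = sigma psi i ^+ 2 by rewrite sqr_sqrtr// ltW.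
apply/matrixP => i j; rewrite !mxE big_ord2 !mxE !big_ord2 !mxE.
rewrite /cond_var /cond_slope !sq.
have := sg ord0; have := sg ord_max.
move: (sigma psi ord0) (sigma psi ord_max) (rho psi) => a b r b0 a0.
have e01 : (ord0 == ord_max :> 'I_2) = false by [].
have e10 : (ord_max == ord0 :> 'I_2) = false by [].
by case: (ord2P i) (ord2P j) => -> [] ->;
  rewrite ?e01 ?e10 ?eqxx ?e01 ?e10 /= ?mulr0n ?mulr1n; field.
Qed.

Lemma component_mx_trig psi : is_trig_mx (component_mx psi).
Proof.
apply/is_trig_mxP => i j ij; rewrite mxE.
rewrite (_ : (i == j) = false); last by apply/negbTE; rewrite neq_ltn ij.
rewrite (_ : (i == ord_max) && (j == ord0) = false) ?mul0r ?subr0//.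
by apply/negbTE; apply: contraTN ij => /andP[_ /eqP ->].
Qed.

Lemma big_mxtens_index (S : Type) (idx : S) (op : Monoid.com_law idx) m n
    (F : 'I_(m * n) -> S) :
  \big[op/idx]_q F q = \big[op/idx]_i \big[op/idx]_k F (mxtens_index (i, k)).
Proof.
rewrite pair_bigA/= (reindex (@mxtens_index m n))/=.
  by apply: eq_bigr => -[].
exists (@mxtens_unindex m n) => q _; first exact: mxtens_indexK.
exact: mxtens_unindexK.
Qed.

(** Indices of the Kronecker product are ordered lexicographically: [p < q] forces [i < j], or
    [i = j] and [k < l]. *)
Lemma tensmx_trig m n (A : 'M[R]_m) (B : 'M[R]_n) :
  is_trig_mx A -> is_trig_mx B -> is_trig_mx (tensmx A B).
Proof.
move=> /is_trig_mxP hA /is_trig_mxP hB; apply/is_trig_mxP => p q.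
case: (mxtens_indexP p) => i k; case: (mxtens_indexP q) => j l.
rewrite tensmxE /= => pq.
have [ij|ji|/val_inj ij] := ltngtP i j.
- by rewrite hA// mul0r.
- have : (i * n + k < j.+1 * n)%N.
    by rewrite (ltn_trans pq)// mulSn addnC ltn_add2r.
  move=> /(leq_ltn_trans (leq_addr _ _)); rewrite ltn_mul2r => /andP[_].
  by rewrite ltnNge ji.
- by move: pq; rewrite ij ltn_add2l => kl; rewrite hB// mulr0.
Qed.

(** The Kronecker product of [component_mx] and [innov_mx] diagonalizes [Sigmamx] by congruence. It
    is triangular with unit diagonal, so [congruence_diag_inv] applies. *)
Lemma nllE n (z : 'I_2 -> R -> R) (s : 'I_n.+1 -> R) psi :
    (forall k l : 'I_n.+1, (k < l)%N -> s k < s l) ->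
    0 < theta psi -> (forall i, 0 < sigsq psi i) -> -1 < rho psi < 1 ->
  let t k := s (inord k) in
  nll z s psi = (2 * n.+1)%:R * ln (2 * pi)
    + nll_sum n t (fun i k => z i (t k)) (theta psi) (sigsq psi ord0)
        (cond_var psi) (cond_slope psi).
Proof.
move=> sm th0 d0 r1 t; rewrite /nll -addrA; congr (_ + _).
have tS i : (i < n)%N -> t i < t i.+1.
  by move=> i_n; rewrite sm// !inordK// ltnW.
have tm i j : (i <= j <= n)%N -> t i <= t j by exact: increasing_le tS.
set th := theta psi.
set L := innov_mx n th t; set LA := component_mx psi.
pose c k := innov_var th t k.
pose dd (i : 'I_2) := if i == ord0 then sigsq psi ord0 else cond_var psi.
have cv0 := cond_var_gt0 d0 r1.
have dd0 i : 0 < dd i by rewrite /dd; case: ifP.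
have c0 (k : 'I_n.+1) : 0 < c k.
  by apply: (innov_var_gt0 th0 tS); rewrite -ltnS.
have RE k l : Rmx psi s k l = ou th t k l by rewrite mxE /ou /t !inord_val.
have LRL : L *m Rmx psi s *m L^T = diag_mx (\row_k c k).
  have RT : (Rmx psi s)^T = Rmx psi s.
    by apply/matrixP => k l; rewrite !mxE distrC.
  (* Transposing exposes both factors [L] on the left, where [mul_innov_mx] computes them. *)
  rewrite -[L *m _]trmxK -trmx_mul; apply/matrixP => k l.
  rewrite mxE mul_innov_mx ![(_^T) _ _]mxE !mul_innov_mx !RE.
  rewrite !inordK ?(leq_ltn_trans (leq_pred _))//.
  rewrite (innov_decorrelated _ tm) -1?ltnS// !mxE mulr_natl.
  by [].
pose M := tensmx LA L.
pose D := tensmx (diag_mx (\row_i dd i)) (diag_mx (\row_(k < n.+1) c k)).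
pose e : 'rV_(2 * n.+1) := \row_q (dd (mxtens_unindex q).1 * c (mxtens_unindex q).2).
have DE : D = diag_mx e.
  apply/matrixP => p q; rewrite /D.
  case: (mxtens_indexP p) => i k; case: (mxtens_indexP q) => j l.
  rewrite tensmxE !mxE mxtens_indexK/= (can_eq (@mxtens_indexK _ _)) xpair_eqE.
  by case: eqP => _; case: eqP => _; rewrite ?mulr0 ?mul0r// !mulr1n.
have MSM : M *m Sigmamx psi s *m M^T = diag_mx e.
  by rewrite /M /Sigmamx trmx_tens !tensmx_mul component_mx_congruence// LRL.
have e0 q : e 0 q != 0 by rewrite mxE gt_eqF// mulr_gt0.
have detM : \det M = 1.
  rewrite det_trig; last first.
    by apply: tensmx_trig; [exact: component_mx_trig|exact: innov_mx_trig].
  rewrite big1// => q _; case: (mxtens_indexP q) => i k.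
  rewrite tensmxE !mxE !eqxx gtn_eqF// mul0r subr0 mulr1.
  by case: i => -[|[|//]] ? /=; rewrite mul0r subr0.
have [-> ->] := congruence_diag_inv (obs z s) MSM e0 detM.
rewrite !big_mxtens_index/=.
have -> : \prod_i \prod_k e 0 (mxtens_index (i, k)) =
    \prod_(k < n.+1) (dd ord0 * c k * (dd ord_max * c k)).
  rewrite big_split big_ord2; congr (_ * _).
    by apply: eq_bigr => k _; rewrite mxE mxtens_indexK.
  by apply: eq_bigr => k _; rewrite mxE mxtens_indexK.
rewrite big_ord2/=.
have lnprod (F : 'I_n.+1 -> R) : (forall k, 0 < F k) ->
    ln (\prod_k F k) = \sum_k ln (F k).
  move=> F0.
  suff [] : 0 < \prod_k F k /\ ln (\prod_k F k) = \sum_k ln (F k) by [].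
  apply: (big_rec2 (fun x y => 0 < x /\ ln x = y)); first by rewrite ln1.
  by move=> i x y _ [x0 <-]; rewrite lnM ?posrE// mulr_gt0.
rewrite lnprod => [|k]; last first.
  by apply: mulr_gt0; apply: mulr_gt0.
rewrite -!big_split/=; apply: eq_bigr => k _.
have Mobs i : (M *m obs z s) (mxtens_index (i, k)) 0 =
    \sum_j LA i j * innov th t (fun l => z j (t l)) k.
  rewrite mxE big_mxtens_index; apply: eq_bigr => j _.
  have := mul_innov_mx th t (\col_(l < n.+1) z j (s l)) k ord0.
  rewrite !mxE /innov /t inord_val => <-; rewrite mulr_sumr.
  by apply: eq_bigr => l _; rewrite tensmxE !mxE mxtens_indexK mulrA.
rewrite !Mobs !big_ord2 !mxE !mxtens_indexK /= /dd/=.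
have ln4 (p q r : R) : 0 < p -> 0 < q -> 0 < r ->
    ln (p * r * (q * r)) = ln p + ln q + 2 * ln r.
  by move=> p0 q0 r0; rewrite !lnM ?posrE ?mulr_gt0//; ring.
rewrite ln4//.
have ck0 : c k != 0 by rewrite gt_eqF.
have s0 : sigsq psi ord0 != 0 by rewrite gt_eqF.
have v0 : cond_var psi != 0 by rewrite gt_eqF.
rewrite /contrast -/(c k); move: (c k) (sigsq psi ord0) (cond_var psi) ck0 s0 v0.
move=> ? ? ? ? ? ?; rewrite ?mulr0n ?mulr1n; field.
by apply/and3P.
Qed.

End likelihood.

(** * Existence of a minimizer *)

Section minimum.
Context (R : realType).

Lemma cvg_bigsum (U I : Type) (F : set_system U) {FF : Filter F} (r : seq I)
    (f : I -> U -> R) (l : I -> R) : (forall i, f i @ F --> l i) ->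
  \sum_(i <- r) f i u @[u --> F] --> \sum_(i <- r) l i.
Proof.
move=> fl; elim: r => [|i r IH].
  by rewrite big_nil; under eq_fun do rewrite big_nil; exact: cvg_cst.
by rewrite big_cons; under eq_fun do rewrite big_cons; exact: cvgD.
Qed.

Lemma cvg_nll_sum (U : Type) (F : set_system U) {FF : Filter F} n t
    (x : 'I_2 -> nat -> R) (th d0 d1 b : U -> R) (th' d0' d1' b' : R) :
    0 < th' -> 0 < d0' -> 0 < d1' -> (forall i, (i < n)%N -> t i < t i.+1) ->
    th @ F --> th' -> d0 @ F --> d0' -> d1 @ F --> d1' -> b @ F --> b' ->
  nll_sum n t x (th u) (d0 u) (d1 u) (b u) @[u --> F]
    --> nll_sum n t x th' d0' d1' b'.
Proof.
move=> th0 d00 d10 tS cth cd0 cd1 cb.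
have car k : ar (th u) t k @[u --> F] --> ar th' t k.
  case: k => [|k]; first exact: cvg_cst.
  have h : - th u * (t k.+1 - t k) @[u --> F] --> - th' * (t k.+1 - t k).
    by apply: cvgM; [exact: cvgN|exact: cvg_cst].
  by apply: (cvg_comp _ _ h); exact: continuous_expR.
have civ k : innov_var (th u) t k @[u --> F] --> innov_var th' t k.
  by apply: cvgB; [exact: cvg_cst|rewrite !expr2; apply: cvgM].
have cin y k : innov (th u) t y k @[u --> F] --> innov th' t y k.
  by apply: cvgB; [exact: cvg_cst|apply: cvgM => //; exact: cvg_cst].
have cln (f : U -> R) (l : R) : 0 < l -> f @ F --> l -> ln (f u) @[u --> F] --> ln l.
  by move=> l0 h; apply: (cvg_comp _ _ h); exact: continuous_ln.
have csq (f : U -> R) (l : R) : f @ F --> l -> f u ^+ 2 @[u --> F] --> l ^+ 2.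
  by move=> h; under eq_fun do rewrite expr2; rewrite expr2; exact: cvgM.
rewrite /nll_sum; apply: cvg_bigsum => k.
have v0 : 0 < innov_var th' t k.
  by apply: innov_var_gt0 th0 tS _; rewrite -ltnS.
apply: cvgD.
  by apply: cvgD; [apply: cvgD; exact: cln|apply: cvgM; [exact: cvg_cst|exact: cln]].
apply: cvgM; last by apply: cvgV; rewrite ?gt_eqF.
apply: cvgD; apply: cvgM; try (by apply: cvgV; rewrite ?gt_eqF).
  exact: csq.
by apply: csq; apply: cvgB => //; exact: cvgM.
Qed.

Lemma box_valid (atheta btheta : R) (asig bsig : 'I_2 -> R) (arho brho : R) psi :
    0 < atheta -> (forall i, 0 < asig i) -> -1 < arho -> brho < 1 ->
    box atheta btheta asig bsig arho brho psi ->
  [/\ 0 < theta psi, forall i, 0 < sigsq psi i & -1 < rho psi < 1].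
Proof.
move=> ath0 asig0 arho1 brho1 [+ hs]; rewrite !in_itv/= => /andP[h1 _] /andP[h2 h3].
split; first exact: lt_le_trans h1.
  by move=> i; have := hs i; rewrite in_itv/= => /andP[+ _]; exact: lt_le_trans.
by rewrite (lt_le_trans arho1)//= (le_lt_trans h3).
Qed.

(** The type [param] carries no topology, so the box is parametrized through [mk] by a compact
    product of four segments, on which the explicit likelihood is continuous. *)
Lemma nll_argmin_exists n (z : 'I_2 -> R -> R) (s : 'I_n.+1 -> R)
    (atheta btheta : R) (asig bsig : 'I_2 -> R) (arho brho : R) psi0 :
    (forall k l : 'I_n.+1, (k < l)%N -> s k < s l) ->
    0 < atheta -> (forall i, 0 < asig i) -> -1 < arho -> brho < 1 ->
    box atheta btheta asig bsig arho brho psi0 ->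
  exists psi, is_argmin (nll z s) (box atheta btheta asig bsig arho brho) psi.
Proof.
move=> sm ath0 asig0 arho1 brho1 [th01 sig01 rho01].
pose mk (p : (R * R) * (R * R)) : param R :=
  Param p.1.1 (fun i => if i == ord0 then p.1.2 else p.2.1) p.2.2.
pose A : set ((R * R) * (R * R)) :=
  (`[atheta, btheta] `*` `[asig ord0, bsig ord0])
  `*` (`[asig ord_max, bsig ord_max] `*` `[arho, brho]).
have cA : compact A by do 2 apply: compact_setX; exact: segment_compact.
have A0 : A !=set0.
  exists ((theta psi0, sigsq psi0 ord0), (sigsq psi0 ord_max, rho psi0)).
  by split; split; rewrite /=; [|exact: sig01|exact: sig01|].
have mkA p : A p -> box atheta btheta asig bsig arho brho (mk p).
  case: p => -[a b] [c e] [[/= pa pb] [/= pc pe]]; split => //= i.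
  by case: (ord2P i) => ->.
pose t k := s (inord k).
pose g p := (2 * n.+1)%:R * ln (2 * pi)
    + nll_sum n t (fun i k => z i (t k)) (theta (mk p)) (sigsq (mk p) ord0)
        (cond_var (mk p)) (cond_slope (mk p)).
have gE p : A p -> nll z s (mk p) = g p.
  by move=> /mkA/(box_valid ath0 asig0 arho1 brho1)[? ? ?]; exact: nllE.
have tS i : (i < n)%N -> t i < t i.+1.
  by move=> i_n; rewrite sm// !inordK// ltnW.
have cg : {within A, continuous g}.
  apply: continuous_in_subspaceT => p /[!inE] pA.
  have [th0 d0 r1] := box_valid ath0 asig0 arho1 brho1 (mkA _ pA).
  have c11 : (q.1.1 : R) @[q --> p] --> p.1.1.
    by apply: (cvg_comp _ _ cvg_fst); exact: cvg_fst.
  have c12 : (q.1.2 : R) @[q --> p] --> p.1.2.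
    by apply: (cvg_comp _ _ cvg_fst); exact: cvg_snd.
  have c21 : (q.2.1 : R) @[q --> p] --> p.2.1.
    by apply: (cvg_comp _ _ cvg_snd); exact: cvg_fst.
  have c22 : (q.2.2 : R) @[q --> p] --> p.2.2.
    by apply: (cvg_comp _ _ cvg_snd); exact: cvg_snd.
  have csqrt (f : (R * R) * (R * R) -> R) (l : R) : f @ p --> l ->
      Num.sqrt (f q) @[q --> p] --> Num.sqrt l.
    by move=> h; apply: (cvg_comp _ _ h); exact: sqrt_continuous.
  apply: cvgD; first exact: cvg_cst.
  apply: cvg_nll_sum => //.
  - exact: cond_var_gt0 d0 r1.
  - apply: cvgM => //; apply: cvgB; first exact: cvg_cst.
    by under eq_fun do rewrite expr2; rewrite expr2; exact: cvgM.
  - rewrite /cond_slope /sigma /=; apply: cvgM.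
      by apply: cvgM => //; exact: csqrt.
    apply: cvgV; last exact: csqrt.
    by rewrite gt_eqF// sqrtr_gt0; exact: (d0 ord0).
have [c cA' cmin] := compact_EVT_min A0 cA cg.
exists (mk c); split; first by apply: mkA; rewrite inE in cA'.
move=> psi psiJ.
pose q := ((theta psi, sigsq psi ord0), (sigsq psi ord_max, rho psi)).
have qE : mk q = psi.
  case: psi {psiJ} @q => a f e /=; congr Param.
  by apply/funext => i; case: (ord2P i) => ->.
have qA : A q.
  by case: psiJ => h1 h2 h3; split; split; rewrite /=; [|exact: h2|exact: h2|].
by rewrite -qE !gE//; [apply: cmin; rewrite inE|rewrite inE in cA'].
Qed.

End minimum.

(** * Pathwise consistency *)

Section deterministic_bounds.
Context (R : realType).
Implicit Types (th : R) (t : nat -> R).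

(* The first observation gets weight 1, so that the total weight of a design in
   [0, 1] is at most 2. *)
Definition gap t k : R := if k is k'.+1 then t k'.+1 - t k' else 1.

Lemma gap_gt0 t n k : (forall i, (i < n)%N -> t i < t i.+1) ->
  (k <= n)%N -> 0 < gap t k.
Proof. by move=> tS; case: k => [|k] kn //=; rewrite subr_gt0 tS. Qed.

Lemma sum_gap t n : \sum_(k < n.+1) gap t k = 1 + (t n - t 0%N).
Proof.
by rewrite big_ord_recl /= -telescope_sumr// big_mkord.
Qed.

Lemma innov_varS th t k :
  innov_var th t k.+1 = 1 - expR (- (2 * th * (t k.+1 - t k))).
Proof. by rewrite /innov_var /= -expRM_natl; congr (1 - expR _); ring. Qed.

Lemma one_sub_expRN_le (x : R) : 1 - expR (- x) <= x.
Proof. by have := expR_ge1Dx (- x); lra. Qed.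

Lemma one_sub_expRN_ge (x : R) : x * expR (- x) <= 1 - expR (- x).
Proof.
have := expR_ge1Dx x; rewrite -(ler_pM2r (expR_gt0 (- x))) -expRD subrr expR0.
lra.
Qed.

Lemma expRN_lipschitz (x y : R) : 0 <= x -> 0 <= y ->
  `|expR (- x) - expR (- y)| <= `|x - y|.
Proof.
wlog xy : x y / x <= y => [hw x0 y0|x0 y0].
  have [xy|/ltW xy] := leP x y; first exact: hw.
  by rewrite distrC (distrC x); exact: hw.
rewrite ger0_norm ?subr_ge0 ?ler_expR ?lerN2// ler0_norm ?subr_le0//.
have -> : expR (- x) - expR (- y) = expR (- x) * (1 - expR (- (y - x))).
  by rewrite mulrBr mulr1 -expRD; congr (_ - expR _); ring.
apply: (@le_trans _ _ (1 * (y - x))); last by lra.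
apply: ler_pM; rewrite ?expR_ge0 ?one_sub_expRN_le//.
  by rewrite subr_ge0 -[leRHS]expR0 ler_expR; lra.
by rewrite -expR0 ler_expR; lra.
Qed.

Section contrast.
(** Throughout, [kappa] is a common bound on parameters and their inverses; the error constants
    depend on it alone, apart from [eta], hence are uniform on the box. *)
Variables (kappa d0 d1 b : R).
Hypotheses (k1 : 1 <= kappa) (d00 : 0 < d0) (d10 : 0 < d1).
Hypotheses (d0k : d0^-1 <= kappa) (d1k : d1^-1 <= kappa) (bk : `|b| <= kappa).

Lemma contrast_ge0 y0 y1 : 0 <= contrast d0 d1 b y0 y1.
Proof. by rewrite addr_ge0// divr_ge0 ?sqr_ge0// ltW. Qed.

Lemma contrast_le y0 y1 :
  contrast d0 d1 b y0 y1 <= 2 * (kappa + kappa ^+ 3) * (y0 ^+ 2 + y1 ^+ 2).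
Proof.
have k0 : 0 <= kappa by exact: le_trans ler01 k1.
have h1 : y0 ^+ 2 / d0 <= y0 ^+ 2 * kappa by rewrite ler_wpM2l ?sqr_ge0.
have b2 : b ^+ 2 <= kappa ^+ 2.
  by rewrite -real_normK ?num_real//; apply: lerXn2r; rewrite ?nnegrE.
have h2 : (y1 - b * y0) ^+ 2 <= 2 * (y1 ^+ 2 + kappa ^+ 2 * y0 ^+ 2).
  have := sqr_ge0 (y1 + b * y0).
  have : b ^+ 2 * y0 ^+ 2 <= kappa ^+ 2 * y0 ^+ 2 by rewrite ler_wpM2r ?sqr_ge0.
  rewrite -subr_ge0 => p q; rewrite -subr_ge0.
  have -> : 2 * (y1 ^+ 2 + kappa ^+ 2 * y0 ^+ 2) - (y1 - b * y0) ^+ 2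
    = (y1 + b * y0) ^+ 2 + 2 * (kappa ^+ 2 * y0 ^+ 2 - b ^+ 2 * y0 ^+ 2) by ring.
  by apply: addr_ge0 => //; apply: mulr_ge0.
have h3 : (y1 - b * y0) ^+ 2 / d1
    <= 2 * (y1 ^+ 2 + kappa ^+ 2 * y0 ^+ 2) * kappa.
  by apply: ler_pM => //; rewrite ?sqr_ge0// invr_ge0 ltW.
apply: (le_trans (lerD h1 h3)); rewrite -subr_ge0.
have -> : 2 * (kappa + kappa ^+ 3) * (y0 ^+ 2 + y1 ^+ 2) - (y0 ^+ 2 * kappa
   + 2 * (y1 ^+ 2 + kappa ^+ 2 * y0 ^+ 2) * kappa)
   = kappa * y0 ^+ 2 + 2 * kappa ^+ 3 * y1 ^+ 2 by ring.
by apply: addr_ge0; rewrite mulr_ge0 ?sqr_ge0// mulr_ge0 ?exprn_ge0.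
Qed.

(** Young's inequality [(u + v) ^ 2 >= (1 - eta) u ^ 2 - v ^ 2 / eta] in each square. It isolates
    the perturbation of the innovations at the price of a fraction [eta] of the main term. *)
Lemma contrastD_ge (eta y0 y1 z0 z1 : R) : 0 < eta ->
  (1 - eta) * contrast d0 d1 b y0 y1 - eta^-1 * contrast d0 d1 b z0 z1
    <= contrast d0 d1 b (y0 + z0) (y1 + z1).
Proof.
move=> e0.
have sq (u v : R) : (1 - eta) * u ^+ 2 - eta^-1 * v ^+ 2 <= (u + v) ^+ 2.
  rewrite -subr_ge0.
  have -> : (u + v) ^+ 2 - ((1 - eta) * u ^+ 2 - eta^-1 * v ^+ 2)
    = eta * (u + v / eta) ^+ 2 + v ^+ 2 by field; rewrite gt_eqF.
  by apply: addr_ge0; rewrite ?sqr_ge0// mulr_ge0 ?sqr_ge0// ltW.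
have sqd (u v c : R) : 0 < c ->
    (1 - eta) * (u ^+ 2 / c) - eta^-1 * (v ^+ 2 / c) <= (u + v) ^+ 2 / c.
  move=> c0; have ci : 0 <= c^-1 by rewrite invr_ge0 ltW.
  by have := ler_wpM2r ci (sq u v); rewrite mulrBl -!mulrA.
have := sqd y0 z0 _ d00; have := sqd (y1 - b * y0) (z1 - b * z0) _ d10.
rewrite /contrast (_ : y1 + z1 - b * (y0 + z0) = y1 - b * y0 + (z1 - b * z0)).
  lra.
by ring.
Qed.

Lemma contrastZ (c y0 y1 : R) :
  contrast d0 d1 b (c * y0) (c * y1) = c ^+ 2 * contrast d0 d1 b y0 y1.
Proof. by rewrite /contrast; ring. Qed.

End contrast.

Section one_term.
Variables (kappa th th0 : R) (t : nat -> R) (n k : nat).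
Hypotheses (k1 : 1 <= kappa) (th_gt0 : 0 < th) (th0_gt0 : 0 < th0).
Hypotheses (thk : th <= kappa) (thV : th^-1 <= kappa).
Hypotheses (th0k : th0 <= kappa) (th0V : th0^-1 <= kappa).
Hypotheses (tS : forall i, (i < n)%N -> t i < t i.+1) (kn : (k <= n)%N).
Hypothesis gap1 : gap t k <= 1.

Let c0 : 0 < innov_var th t k. Proof. exact: (innov_var_gt0 _ tS). Qed.
Let c00 : 0 < innov_var th0 t k. Proof. exact: (innov_var_gt0 _ tS). Qed.
Let k0 : 0 <= kappa. Proof. exact: le_trans ler01 k1. Qed.

(** With [D] the gap, [1 - expR (- (2 * th * D))] lies between [2 * th * D * expR (- (2 * th * D))]
    and [2 * th * D], so the ratio of variances is [th / th0] up to [expR (- (2 * th * D))]. At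
    [k = 0] both variances are 1 and the gap 1 lets [kappa ^ 2] absorb the logarithms. *)
Lemma ln_innov_var_ge :
  ln th - ln th0 - (2 * kappa + kappa ^+ 2) * gap t k
    <= ln (innov_var th t k) - ln (innov_var th0 t k).
Proof.
have kp := k0; have p3 := thk; move: c0 c00 gap1; case: k kn => [_|i ik] /=.
  move=> _ _ _; rewrite /innov_var /= expr0n/= subr0 subrr mulr1.
  have q0 : 0 < th / th0 by rewrite divr_gt0.
  have : ln (th / th0) <= th / th0 - 1.
    by have := expR_ge1Dx (ln (th / th0)); rewrite lnK ?posrE//; lra.
  rewrite ln_div ?posrE//.
  have : th / th0 <= kappa * kappa by apply: ler_pM => //; rewrite ?invr_ge0 ltW.
  rewrite -expr2; lra.
rewrite !innov_varS; set D := t i.+1 - t i => p p0 D1.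
have D0 : 0 < D by rewrite subr_gt0 tS.
have : ln (2 * th * D * expR (- (2 * th * D))) <= ln (1 - expR (- (2 * th * D))).
  by rewrite ler_ln ?posrE ?one_sub_expRN_ge ?mulr_gt0 ?expR_gt0.
have : ln (1 - expR (- (2 * th0 * D))) <= ln (2 * th0 * D).
  by rewrite ler_ln ?posrE ?one_sub_expRN_le ?mulr_gt0.
rewrite !lnM ?posrE ?mulr_gt0 ?expR_gt0// expRK.
have : th * D <= kappa * D by rewrite ler_wpM2r// ltW.
have : 0 <= kappa ^+ 2 * D by rewrite mulr_ge0 ?exprn_ge0// ltW.
lra.
Qed.

(** The same two-sided bound, now for inverses. At [k = 0] the left-hand side is nonpositive. *)
Lemma innov_var_ratio_ge :
  th0 / th * (1 - (2 * kappa + 1) * gap t k) / innov_var th0 t k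
    <= (innov_var th t k)^-1.
Proof.
have kp := k0; have p4 := th0k; move: c0 c00 gap1; case: k kn => [_|i ik] /=.
  move=> _ _ _; rewrite /innov_var /= expr0n/= subr0 invr1 !mulr1.
  apply: (@le_trans _ _ 0) => //.
  by rewrite mulr_ge0_le0 ?divr_ge0 ?(ltW th_gt0) ?(ltW th0_gt0)//; lra.
rewrite !innov_varS; set D := t i.+1 - t i => p p0 D1.
have D0 : 0 < D by rewrite subr_gt0 tS.
have v0 : 0 < 2 * th * D by rewrite !mulr_gt0.
apply: (@le_trans _ _ (2 * th * D)^-1); last first.
  by rewrite lef_pV2 ?posrE// one_sub_expRN_le.
rewrite ler_pdivrMr// -(ler_pM2l v0) [leRHS]mulrA divff ?gt_eqF// mul1r.
have -> : 2 * th * D * (th0 / th * (1 - (2 * kappa + 1) * D))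
   = 2 * th0 * D * (1 - (2 * kappa + 1) * D) by field; rewrite gt_eqF.
apply: le_trans (one_sub_expRN_ge _).
rewrite ler_wpM2l ?mulr_ge0 ?(ltW D0) ?(ltW th0_gt0)//.
have := expR_ge1Dx (- (2 * th0 * D)).
have : th0 * D <= kappa * D by rewrite ler_wpM2r// ltW.
lra.
Qed.

(** The coefficients differ by at most [kappa] times the gap, while the variance is at least of the
    order of the gap, so the quotient is linear in it. At [k = 0] the coefficients coincide. *)
Lemma ar_diff_sqr_le :
  (ar th0 t k - ar th t k) ^+ 2 / innov_var th t k
    <= kappa ^+ 3 * expR (2 * kappa) * gap t k.
Proof.
have p1 := th_gt0; have p2 := th0_gt0; have p3 := thk; have p4 := th0k.
move: c0 c00 gap1; case: k kn => [_|i ik] /=.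
  move=> _ _ _; rewrite subrr expr0n/= mul0r mulr1.
  by rewrite mulr_ge0 ?exprn_ge0 ?expR_ge0.
rewrite !innov_varS; set D := t i.+1 - t i => p p0 D1.
have D0 : 0 < D by rewrite subr_gt0 tS.
rewrite ler_pdivrMr//.
have a2 : (expR (- th0 * D) - expR (- th * D)) ^+ 2 <= (kappa * D) ^+ 2.
  rewrite -[leLHS]real_normK ?num_real//; apply: lerXn2r; rewrite ?nnegrE//.
    by rewrite mulr_ge0// ltW.
  rewrite !mulNr (le_trans (expRN_lipschitz _ _))// ?mulr_ge0 ?(ltW D0)
    ?(ltW th0_gt0) ?(ltW th_gt0)//.
  rewrite -mulrBl normrM (gtr0_norm D0) ler_wpM2r ?(ltW D0)//.
  by rewrite ler_norml; apply/andP; split; lra.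
apply: (le_trans a2).
have tk : 1 <= th * kappa by rewrite -ler_pdivrMl// mulr1.
have h1 : expR (- (2 * kappa)) <= expR (- (2 * th * D)).
  rewrite ler_expR lerN2 -mulrA ler_pM2l//.
  by rewrite -[leRHS]mulr1 ler_pM// ltW.
have h2 := one_sub_expRN_ge (2 * th * D).
have h3 : 2 * th * D * expR (- (2 * kappa)) <= 1 - expR (- (2 * th * D)).
  by apply: le_trans h2; rewrite ler_wpM2l// !mulr_ge0 ?ltW.
have KD0 : 0 <= kappa ^+ 3 * expR (2 * kappa) * D.
  by rewrite !mulr_ge0 ?exprn_ge0 ?expR_ge0// ltW.
apply: le_trans (ler_wpM2l KD0 h3).
have -> : kappa ^+ 3 * expR (2 * kappa) * D * (2 * th * D * expR (- (2 * kappa)))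
   = (kappa * D) ^+ 2 * (2 * (th * kappa)) *
     (expR (2 * kappa) * expR (- (2 * kappa))) by ring.
rewrite -expRD subrr expR0 mulr1 ler_peMr ?sqr_ge0//; lra.
Qed.

End one_term.
End deterministic_bounds.

(** * Lower bound for the excess likelihood *)

Section lower_bound.
Context (R : realType).

(** The mean of [contrast] under a law with second moments [m00], [m01], [m11], in which it is
    linear. *)
Definition mean_contrast (d0 d1 b m00 m01 m11 : R) : R :=
  m00 / d0 + (m11 - 2 * b * m01 + b ^+ 2 * m00) / d1.

Definition avg n (f : nat -> R) := n.+1%:R^-1 * \sum_(k < n.+1) f k.

Lemma avg_cst n c : avg n (fun=> c) = c.
Proof.
by rewrite /avg sumr_const card_ord -(mulr_natl c) mulrA mulVf ?mul1r ?pnatr_eq0.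
Qed.

Lemma avgD n f g : avg n (fun k => f k + g k) = avg n f + avg n g.
Proof. by rewrite /avg big_split/= mulrDr. Qed.

Lemma avgZ n c f : avg n (fun k => c * f k) = c * avg n f.
Proof. by rewrite /avg -mulr_sumr mulrCA. Qed.

Lemma avgB n f g : avg n (fun k => f k - g k) = avg n f - avg n g.
Proof. by rewrite /avg sumrB mulrBr. Qed.

Lemma avg_le n f g : (forall k, (k <= n)%N -> f k <= g k) -> avg n f <= avg n g.
Proof.
by move=> fg; rewrite ler_wpM2l// ler_sum// => k _; rewrite fg// -ltnS.
Qed.

Lemma sum_contrast n (d0 d1 b : R) (w0 w1 : 'I_n -> R) :
  \sum_k contrast d0 d1 b (w0 k) (w1 k)
  = mean_contrast d0 d1 b (\sum_k w0 k * w0 k) (\sum_k w0 k * w1 k)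
      (\sum_k w1 k * w1 k).
Proof.
rewrite /mean_contrast mulr_sumr mulr_sumr -sumrB -big_split/= !mulr_suml.
rewrite -big_split/=; apply: eq_bigr => k _; rewrite /contrast.
by congr (_ * _ + _ * _); ring.
Qed.

Lemma mean_contrastZ (d0 d1 b m00 m01 m11 c : R) :
  mean_contrast d0 d1 b (c * m00) (c * m01) (c * m11)
  = c * mean_contrast d0 d1 b m00 m01 m11.
Proof. by rewrite /mean_contrast; ring. Qed.

Lemma mean_contrast_lipschitz (kappa d0 d1 b m00 m01 m11 p00 p01 p11 : R) :
    1 <= kappa -> 0 < d0 -> 0 < d1 -> d0^-1 <= kappa -> d1^-1 <= kappa ->
    `|b| <= kappa ->
  `|mean_contrast d0 d1 b m00 m01 m11 - mean_contrast d0 d1 b p00 p01 p11|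
    <= 2 * (kappa + kappa ^+ 3)
       * (`|m00 - p00| + `|m01 - p01| + `|m11 - p11|).
Proof.
move=> k1 d00 d10 d0k d1k bk.
have k0 : 0 <= kappa by lra.
have V0 : 0 <= d0^-1 by rewrite invr_ge0 ltW.
have V1 : 0 <= d1^-1 by rewrite invr_ge0 ltW.
have -> : mean_contrast d0 d1 b m00 m01 m11 - mean_contrast d0 d1 b p00 p01 p11
  = (d0^-1 + b ^+ 2 * d1^-1) * (m00 - p00) + (- 2 * b * d1^-1) * (m01 - p01)
    + d1^-1 * (m11 - p11) by rewrite /mean_contrast; ring.
have K2 : 2 * kappa ^+ 2 <= kappa + kappa ^+ 3.
  rewrite -subr_ge0.
  have -> : kappa + kappa ^+ 3 - 2 * kappa ^+ 2 = kappa * (kappa - 1) ^+ 2 by ring.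
  by rewrite mulr_ge0 ?sqr_ge0.
have K3 : 0 <= kappa ^+ 3 by rewrite exprn_ge0.
have b2 : b ^+ 2 * d1^-1 <= kappa ^+ 3.
  rewrite (exprSr kappa 2) -[b ^+ 2]real_normK ?num_real//.
  by apply: ler_pM => //; rewrite ?sqr_ge0//; apply: lerXn2r; rewrite ?nnegrE.
have bd : `|b| * d1^-1 <= kappa ^+ 2 by rewrite expr2; apply: ler_pM.
have c0 : `|d0^-1 + b ^+ 2 * d1^-1| <= 2 * (kappa + kappa ^+ 3).
  rewrite ger0_norm; first lra.
  by apply: addr_ge0 => //; apply: mulr_ge0 => //; exact: sqr_ge0.
have c1 : `|- 2 * b * d1^-1| <= 2 * (kappa + kappa ^+ 3).
  rewrite !normrM normrN (ger0_norm V1) -mulrA (ger0_norm (ler0n _ 2)); lra.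
have c2 : `|d1^-1| <= 2 * (kappa + kappa ^+ 3) by rewrite ger0_norm//; lra.
set M := 2 * (kappa + kappa ^+ 3) in c0 c1 c2 *.
rewrite [leRHS]mulrDr [X in _ <= X + _]mulrDr; apply: (le_trans (ler_normD _ _)).
apply: lerD; last by rewrite normrM ler_wpM2r.
apply: (le_trans (ler_normD _ _)).
by apply: lerD; rewrite normrM ler_wpM2r.
Qed.

Section design.
Variables (kappa th0 e0 e1 b0 th d0 d1 b eta : R) (n : nat) (t : nat -> R).
Variable (x : 'I_2 -> nat -> R).
Hypotheses (k1 : 1 <= kappa) (th_gt0 : 0 < th) (th0_gt0 : 0 < th0).
Hypotheses (thk : th <= kappa) (thV : th^-1 <= kappa).
Hypotheses (th0k : th0 <= kappa) (th0V : th0^-1 <= kappa).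
Hypotheses (d00 : 0 < d0) (d10 : 0 < d1).
Hypotheses (d0k : d0^-1 <= kappa) (d1k : d1^-1 <= kappa) (bk : `|b| <= kappa).
Hypotheses (eta0 : 0 < eta <= 1).
Hypotheses (tS : forall i, (i < n)%N -> t i < t i.+1).
Hypothesis (t01 : t n - t 0%N <= 1).

(** Normalized in time only: when [th0] is the true value, these are uncorrelated in [k], and the
    covariance of the two components at equal times is that of the process. *)
Definition std_innov i k : R :=
  innov th0 t (x i) k / Num.sqrt (innov_var th0 t k).

Let w0 := std_innov ord0.
Let w1 := std_innov ord_max.
Let M := 2 * (kappa + kappa ^+ 3).
Let K1 := 2 * (2 * kappa + kappa ^+ 2).
Let K2 := 2 * kappa + 1.
Let K3 := kappa ^+ 3 * expR (2 * kappa).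
Let r := th0 / th.

Let gap_le1 k : (k <= n)%N -> gap t k <= 1.
Proof.
case: k => [|k] kn //=.
have h1 := @increasing_le _ t n k.+1 n tS.
have h2 := @increasing_le _ t n 0%N k tS; have h3 := t01.
rewrite kn leqnn in h1; rewrite (ltnW kn) in h2.
by move: (h1 isT) (h2 isT); lra.
Qed.

Lemma innov_sub y k : innov th t y k
  = innov th0 t y k + (ar th0 t k - ar th t k) * y k.-1.
Proof. by rewrite /innov; ring. Qed.

(** The [K1] error comes from the logarithms, the [K2] error from the ratio of variances, and the
    [K3] error from the change of autoregression coefficient, split off by [contrastD_ge]. Each
    carries a factor [gap t k]. *)
Lemma nll_term_ge k : (k <= n)%N ->
  (ln d0 + ln d1 + 2 * ln th) - (ln e0 + ln e1 + 2 * ln th0)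
    + (1 - eta) * r * contrast d0 d1 b (w0 k) (w1 k)
    - contrast e0 e1 b0 (w0 k) (w1 k)
    - K1 * gap t k - r * K2 * M * (gap t k * (w0 k ^+ 2 + w1 k ^+ 2))
    - eta^-1 * K3 * M * (gap t k * (x ord0 k.-1 ^+ 2 + x ord_max k.-1 ^+ 2))
  <= (ln d0 + ln d1 + 2 * ln (innov_var th t k)
      + contrast d0 d1 b (innov th t (x ord0) k) (innov th t (x ord_max) k)
        / innov_var th t k)
   - (ln e0 + ln e1 + 2 * ln (innov_var th0 t k)
      + contrast e0 e1 b0 (innov th0 t (x ord0) k) (innov th0 t (x ord_max) k)
        / innov_var th0 t k).
Proof.
move=> kn.
have g1 := gap_le1 kn.
have kap0 : 0 <= kappa by exact: le_trans ler01 k1.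
have g0 : 0 <= gap t k by exact: ltW (gap_gt0 tS kn).
have c0 : 0 < innov_var th t k by exact: (innov_var_gt0 _ tS).
have c00 : 0 < innov_var th0 t k by exact: (innov_var_gt0 _ tS).
have hln := ln_innov_var_ge k1 th_gt0 th0_gt0 thk th0V tS kn g1.
have hratio := innov_var_ratio_ge k1 th_gt0 th0_gt0 th0k tS kn g1.
have har := ar_diff_sqr_le k1 th_gt0 th0_gt0 thk thV th0k tS kn g1.
rewrite -/K2 -/r in hratio; rewrite -/K3 in har.
have wE (f0 f1 g : R) : contrast f0 f1 g (w0 k) (w1 k)
    = contrast f0 f1 g (innov th0 t (x ord0) k) (innov th0 t (x ord_max) k)
      / innov_var th0 t k.
  rewrite /w0 /w1 /std_innov ![_ / Num.sqrt _]mulrC contrastZ.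
  by rewrite exprVn sqr_sqrtr ?ltW// mulrC.
rewrite (wE e0 e1 b0).
set y0 := innov th0 t (x ord0) k; set y1 := innov th0 t (x ord_max) k.
set z0 := x ord0 k.-1; set z1 := x ord_max k.-1.
have NWM := contrast_le k1 d10 d0k d1k bk (w0 k) (w1 k).
have NZM := contrast_le k1 d10 d0k d1k bk z0 z1.
have NW0 := contrast_ge0 b d00 d10 (w0 k) (w1 k).
have NZ0 := contrast_ge0 b d00 d10 z0 z1.
have NY0 := contrast_ge0 b d00 d10 y0 y1.
have NWE := wE d0 d1 b; rewrite -/y0 -/y1 in NWE.
rewrite -/M in NWM NZM.
set NW := contrast d0 d1 b (w0 k) (w1 k) in NWM NW0 NWE *.
rewrite !(innov_sub _ k) -/y0 -/y1 -/z0 -/z1.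
set a := ar th0 t k - ar th t k in har *.
have /andP[eta_gt0 eta1] := eta0.
have hadd := contrastD_ge b d00 d10 y0 y1 (a * z0) (a * z1) eta_gt0.
rewrite contrastZ in hadd.
set NY := contrast d0 d1 b y0 y1 in NY0 NWE hadd.
set NZ := contrast d0 d1 b z0 z1 in NZM NZ0 hadd.
set C0 := contrast e0 e1 b0 y0 y1 / _.
set Nyz := contrast d0 d1 b (y0 + _) _ in hadd *.
set c := innov_var th t k in c0 hln hratio har *.
set c' := innov_var th0 t k in c00 hln hratio NWE *.
set g := gap t k in g0 hln hratio har *.
have r0 : 0 <= r by rewrite divr_ge0 ?ltW.
have K20 : 0 <= K2 by rewrite /K2 addr_ge0// mulr_ge0.
have cV0 : 0 <= c^-1 by rewrite invr_ge0 ltW.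
have h1 : ((1 - eta) * NY - eta^-1 * (a ^+ 2 * NZ)) / c <= Nyz / c.
  by rewrite ler_wpM2r.
have h2 : r * (1 - K2 * g) * NW <= NY / c.
  have := ler_wpM2l NY0 hratio; rewrite NWE; congr (_ <= _); ring.
have h3 : (1 - eta) * (r * (1 - K2 * g) * NW) <= (1 - eta) * (NY / c).
  by rewrite ler_wpM2l// subr_ge0.
have h4 : 0 <= eta * (r * K2 * (g * NW)).
  by apply: mulr_ge0; [exact: ltW|apply: mulr_ge0; exact: mulr_ge0].
have h5 : r * K2 * (g * NW) <= r * K2 * (g * (M * (w0 k ^+ 2 + w1 k ^+ 2))).
  by apply: ler_wpM2l; [exact: mulr_ge0|exact: ler_wpM2l].
have h6 : eta^-1 * ((a ^+ 2 / c) * NZ) <= eta^-1 * ((K3 * g) * (M * (z0 ^+ 2 + z1 ^+ 2))).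
  rewrite ler_wpM2l ?invr_ge0 ?(ltW eta_gt0)//.
  by apply: ler_pM => //; rewrite mulr_ge0 ?sqr_ge0.
have k1' : 0 <= kappa ^+ 2 * g by rewrite mulr_ge0// exprn_ge0.
rewrite /K1; move: h1 h2 h3 h4 h5 h6 hln.
move: (ln c) (ln c') (ln d0) (ln d1) (ln e0) (ln e1) (ln th) (ln th0).
move=> *; lra.
Qed.

(** Averages the termwise bounds; the gaps sum to at most 2, which leaves [2 * K1] over the number
    of points. *)
Lemma nll_sum_ge (m := fun i j => avg n (fun k => std_innov i k * std_innov j k)) :
  (ln d0 + ln d1 + 2 * ln th) - (ln e0 + ln e1 + 2 * ln th0)
    + (1 - eta) * r * mean_contrast d0 d1 b (m ord0 ord0) (m ord0 ord_max)
        (m ord_max ord_max)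
    - mean_contrast e0 e1 b0 (m ord0 ord0) (m ord0 ord_max) (m ord_max ord_max)
    - 2 * K1 * n.+1%:R^-1
    - r * K2 * M * avg n (fun k => gap t k * (w0 k ^+ 2 + w1 k ^+ 2))
    - eta^-1 * K3 * M
        * avg n (fun k => gap t k * (x ord0 k.-1 ^+ 2 + x ord_max k.-1 ^+ 2))
  <= n.+1%:R^-1 * (nll_sum n t x th d0 d1 b - nll_sum n t x th0 e0 e1 b0).
Proof.
have mE (f0 f1 g : R) : avg n (fun k => contrast f0 f1 g (w0 k) (w1 k))
    = mean_contrast f0 f1 g (m ord0 ord0) (m ord0 ord_max) (m ord_max ord_max).
  by rewrite /avg sum_contrast -mean_contrastZ.
have gE : avg n (gap t) <= 2 * n.+1%:R^-1.
  rewrite /avg sum_gap mulrC ler_wpM2r// lerD2l; exact: t01.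
have kap0 : 0 <= kappa by exact: le_trans ler01 k1.
have K10 : 0 <= K1 by rewrite mulr_ge0// addr_ge0 ?exprn_ge0// mulr_ge0.
have /(ler_wpM2l K10) gE' := gE.
rewrite /nll_sum -sumrB.
apply: le_trans (avg_le nll_term_ge).
rewrite !avgB avgD !avgZ avg_cst !mE.
by rewrite !lerD2r lerD2l lerN2 (le_trans gE')// mulrCA mulrA.
Qed.

End design.
End lower_bound.

(** * Convergence of minimizers on a fixed trajectory *)

Section consistency.
Context (R : realType).

(** Comes from [ln x = 2 * ln (sqrt x) <= 2 * (sqrt x - 1)]. It turns a vanishing divergence into
    convergence of the ratio [x] to 1. *)
Lemma sub1_sub_ln_ge (x : R) : 0 < x -> (Num.sqrt x - 1) ^+ 2 <= x - 1 - ln x.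
Proof.
move=> x0; have s0 : 0 < Num.sqrt x by rewrite sqrtr_gt0.
have xE : x = Num.sqrt x ^+ 2 by rewrite sqr_sqrtr// ltW.
have : ln x = 2 * ln (Num.sqrt x).
  by rewrite {1}xE lnXn// mulr_natl.
have : ln (Num.sqrt x) <= Num.sqrt x - 1.
  by have := expR_ge1Dx (ln (Num.sqrt x)); rewrite lnK ?posrE//; lra.
by rewrite [in X in _ -> _ -> _ <= X - _ - _]xE sqrrB; lra.
Qed.

(* Twice the Kullback-Leibler divergence between two centered bivariate
   Gaussian laws, split into the first component and the second given the
   first. *)
Lemma divergence_ge (th0 e0 e1 b0 th d0 d1 b : R) :
    0 < th0 -> 0 < e0 -> 0 < e1 -> 0 < th -> 0 < d0 -> 0 < d1 ->
  (Num.sqrt (th0 * e0 / (th * d0)) - 1) ^+ 2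
    + (Num.sqrt (th0 * e1 / (th * d1)) - 1) ^+ 2
    + th0 / th * (e0 / d1) * (b - b0) ^+ 2
  <= (ln d0 + ln d1 + 2 * ln th) - (ln e0 + ln e1 + 2 * ln th0)
    + th0 / th * mean_contrast d0 d1 b e0 (b0 * e0) (e1 + b0 ^+ 2 * e0) - 2.
Proof.
move=> th00 e00 e10 thp d00 d10.
have p0 : 0 < th0 * e0 / (th * d0) by rewrite divr_gt0 ?mulr_gt0.
have v0 : 0 < th0 * e1 / (th * d1) by rewrite divr_gt0 ?mulr_gt0.
have := lerD (sub1_sub_ln_ge p0) (sub1_sub_ln_ge v0).
rewrite !ln_div ?posrE ?mulr_gt0// !lnM ?posrE//.
have -> : th0 / th * mean_contrast d0 d1 b e0 (b0 * e0) (e1 + b0 ^+ 2 * e0)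
   = th0 * e0 / (th * d0) + th0 * e1 / (th * d1)
     + th0 / th * (e0 / d1) * (b - b0) ^+ 2.
  by rewrite /mean_contrast; field; rewrite !gt_eqF.
lra.
Qed.

(** The order of limits matters: [eta] is fixed first so that [eta * C] is small, then [n] is taken
    large. *)
Lemma cvg_of_eventually_le (u : nat -> R) (C : R) (v : R -> nat -> R) :
    (forall n, 0 <= u n) -> (forall eta n, 0 < eta <= 1 -> u n <= eta * C + v eta n) ->
    (forall eta, 0 < eta <= 1 -> v eta n @[n --> \oo] --> 0) ->
  u n @[n --> \oo] --> 0.
Proof.
move=> u0 uv v0; apply/cvgr0Pnorm_lt => eps eps0.
pose C' := `|C| + 1.
have C'0 : 0 < C' by rewrite /C' ltr_wpDl.
pose eta := Num.min 1 (eps / 2 / C').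
have eta01 : 0 < eta <= 1.
  rewrite /eta lt_min ltr01 ge_min lexx/= !divr_gt0//.
have etaC : eta * C <= eps / 2.
  have /andP[e0 _] := eta01.
  apply: (@le_trans _ _ (eta * C')).
    by rewrite ler_wpM2l ?(ltW e0)// /C' (le_trans (ler_norm C))// lerDl.
  by rewrite -ler_pdivlMr// /eta ge_min lexx orbT.
near=> n.
rewrite ger0_norm// (le_lt_trans (uv eta n eta01))//.
have : v eta n < eps / 2.
  rewrite (le_lt_trans (ler_norm _))//; near: n.
  by move/cvgr0Pnorm_lt : (v0 _ eta01); apply; rewrite divr_gt0.
lra.
Unshelve. all: by end_near. Qed.

Lemma cvg_sqrt_ratio (q0 : R) (q : nat -> R) : 0 < q0 -> (forall n, 0 < q n) ->
  (Num.sqrt (q0 / q n) - 1) ^+ 2 @[n --> \oo] --> 0 ->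
  q n @[n --> \oo] --> q0.
Proof.
move=> q00 qn /cvg0_of_exprn h.
have h1 : Num.sqrt (q0 / q n) @[n --> \oo] --> (1 : R).
  have : Num.sqrt (q0 / q n) - 1 + 1 @[n --> \oo] --> 0 + (1 : R).
    by apply: cvgD => //; exact: cvg_cst.
  by rewrite add0r; under eq_fun do rewrite subrK.
have h2 : q0 / (Num.sqrt (q0 / q n) * Num.sqrt (q0 / q n)) @[n --> \oo]
    --> q0 / (1 * 1).
  apply: cvgM; first exact: cvg_cst.
  by apply: cvgV; [rewrite mulr1 oner_neq0|exact: cvgM].
rewrite mulr1 divr1 in h2; apply: cvg_trans h2; apply: near_eq_cvg.
apply: nearW => n; rewrite -expr2 sqr_sqrtr ?divr_ge0 ?ltW//.
by rewrite invf_div mulrC divfK// gt_eqF.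
Qed.

Definition in_bounds (kappa th d0 d1 b : R) : Prop :=
  [/\ [/\ 0 < th, th <= kappa & th^-1 <= kappa],
      [/\ 0 < d0, d0 <= kappa & d0^-1 <= kappa],
      [/\ 0 < d1, d1 <= kappa & d1^-1 <= kappa] & `|b| <= kappa].

Definition innov_cov th n t (x : 'I_2 -> nat -> R) i j : R :=
  avg n (fun k => std_innov th t x i k * std_innov th t x j k).

(** Together with [lag_energy], the random part of the error terms in [nll_sum_ge]. *)
Definition innov_energy th n t (x : 'I_2 -> nat -> R) : R :=
  avg n (fun k => gap t k
    * (std_innov th t x ord0 k ^+ 2 + std_innov th t x ord_max k ^+ 2)).

Definition lag_energy n (t : nat -> R) (x : 'I_2 -> nat -> R) : R :=
  avg n (fun k => gap t k * (x ord0 k.-1 ^+ 2 + x ord_max k.-1 ^+ 2)).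

Variables (kappa th0 e0 e1 b0 : R).
Variables (t : nat -> nat -> R) (x : nat -> 'I_2 -> nat -> R).
Variables (th d0 d1 b : nat -> R).
Hypothesis k1 : 1 <= kappa.
Hypothesis true_bounds : in_bounds kappa th0 e0 e1 b0.
Hypothesis bounds : forall n, in_bounds kappa (th n) (d0 n) (d1 n) (b n).
Hypothesis tS : forall n i, (i < n)%N -> t n i < t n i.+1.
Hypothesis t01 : forall n, t n n - t n 0%N <= 1.
Hypothesis hmin : forall n,
  nll_sum n (t n) (x n) (th n) (d0 n) (d1 n) (b n)
    <= nll_sum n (t n) (x n) th0 e0 e1 b0.

Let w n := std_innov th0 (t n) (x n).
Let m n := innov_cov th0 n (t n) (x n).
Hypothesis m00 : m n ord0 ord0 @[n --> \oo] --> e0.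
Hypothesis m01 : m n ord0 ord_max @[n --> \oo] --> b0 * e0.
Hypothesis m11 : m n ord_max ord_max @[n --> \oo] --> e1 + b0 ^+ 2 * e0.
Let E1 n := innov_energy th0 n (t n) (x n).
Let E2 n := lag_energy n (t n) (x n).
Hypothesis E10 : E1 n @[n --> \oo] --> 0.
Hypothesis E20 : E2 n @[n --> \oo] --> 0.

Let th0_gt0 : 0 < th0. Proof. by case: true_bounds => -[]. Qed.
Let th0k : th0 <= kappa. Proof. by case: true_bounds => -[]. Qed.
Let th0V : th0^-1 <= kappa. Proof. by case: true_bounds => -[]. Qed.
Let e00 : 0 < e0. Proof. by case: true_bounds => _ []. Qed.
Let e0k : e0 <= kappa. Proof. by case: true_bounds => _ []. Qed.
Let e0V : e0^-1 <= kappa. Proof. by case: true_bounds => _ []. Qed.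
Let e10 : 0 < e1. Proof. by case: true_bounds => _ _ []. Qed.
Let e1k : e1 <= kappa. Proof. by case: true_bounds => _ _ []. Qed.
Let e1V : e1^-1 <= kappa. Proof. by case: true_bounds => _ _ []. Qed.
Let b0k : `|b0| <= kappa. Proof. by case: true_bounds. Qed.
Let th_gt0 n : 0 < th n. Proof. by case: (bounds n) => -[]. Qed.
Let thk n : th n <= kappa. Proof. by case: (bounds n) => -[]. Qed.
Let thV n : (th n)^-1 <= kappa. Proof. by case: (bounds n) => -[]. Qed.
Let d0_gt0 n : 0 < d0 n. Proof. by case: (bounds n) => _ []. Qed.
Let d0V n : (d0 n)^-1 <= kappa. Proof. by case: (bounds n) => _ []. Qed.
Let d1_gt0 n : 0 < d1 n. Proof. by case: (bounds n) => _ _ []. Qed.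
Let d1k n : d1 n <= kappa. Proof. by case: (bounds n) => _ _ []. Qed.
Let d1V n : (d1 n)^-1 <= kappa. Proof. by case: (bounds n) => _ _ []. Qed.
Let bk n : `|b n| <= kappa. Proof. by case: (bounds n). Qed.

Let G n := (ln (d0 n) + ln (d1 n) + 2 * ln (th n)) - (ln e0 + ln e1 + 2 * ln th0)
  + th0 / th n * mean_contrast (d0 n) (d1 n) (b n) e0 (b0 * e0)
      (e1 + b0 ^+ 2 * e0) - 2.

Let G_ge n := divergence_ge b0 (b n) th0_gt0 e00 e10 (th_gt0 n) (d0_gt0 n) (d1_gt0 n)
  : _ <= G n.

Let kap0 : 0 <= kappa. Proof. exact: le_trans ler01 k1. Qed.
Let r_ge0 n : 0 <= th0 / th n. Proof. by rewrite divr_ge0 ?ltW. Qed.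
Let r_le n : th0 / th n <= kappa ^+ 2.
Proof. by rewrite expr2; apply: ler_pM => //; rewrite ?invr_ge0 ltW. Qed.

Let cross_ge0 n : 0 <= th0 / th n * (e0 / d1 n) * (b n - b0) ^+ 2.
Proof. by rewrite mulr_ge0 ?sqr_ge0// mulr_ge0// divr_ge0 ?ltW. Qed.

(** Minimality makes the averaged excess nonpositive, so [nll_sum_ge] bounds the divergence [G] by
    [eta * C] plus the fluctuations of the empirical moments and the energies, all tending to 0. *)
Let G_cvg0 : G n @[n --> \oo] --> 0.
Proof.
pose M := 2 * (kappa + kappa ^+ 3).
pose K1 := 2 * (2 * kappa + kappa ^+ 2).
pose K2 := 2 * kappa + 1.
pose K3 := kappa ^+ 3 * expR (2 * kappa).
pose dm n := `|m n ord0 ord0 - e0| + `|m n ord0 ord_max - b0 * e0|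
  + `|m n ord_max ord_max - (e1 + b0 ^+ 2 * e0)|.
(* Bounds [th0 / th n] times the mean contrast under the true moments, that is, the term to which
   the loss factor [1 - eta] applies. *)
pose C := kappa ^+ 2 * (kappa * kappa + (kappa + (2 * kappa) ^+ 2 * kappa) * kappa).
pose v eta n := (kappa ^+ 2 + 1) * (M * dm n) + 2 * K1 * n.+1%:R^-1
  + kappa ^+ 2 * (K2 * M * E1 n) + eta^-1 * K3 * M * E2 n.
have M0 : 0 <= M by rewrite mulr_ge0// addr_ge0// exprn_ge0.
have K20 : 0 <= K2 by rewrite addr_ge0// mulr_ge0.
have E1_ge0 n : 0 <= E1 n.
  rewrite /E1 -(avg_cst n 0); apply: avg_le => k kn.
  rewrite mulr_ge0 ?addr_ge0 ?sqr_ge0//; exact/ltW/(gap_gt0 (@tS n)).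
apply: (@cvg_of_eventually_le G C v).
- move=> n; apply: le_trans (G_ge n).
  by rewrite !addr_ge0 ?sqr_ge0.
- move=> eta n eta01; have /andP[eta0 eta1] := eta01.
  have := nll_sum_ge e0 e1 b0 (x n) k1 (th_gt0 n) th0_gt0 (thk n) (thV n) th0k th0V
    (d0_gt0 n) (d1_gt0 n) (d0V n) (d1V n) (bk n) eta01 (@tS n) (t01 n).
  rewrite -/M -/K1 -/K2 -/K3.
  rewrite -/(innov_energy th0 n (t n) (x n)) -/(lag_energy n (t n) (x n)).
  rewrite -!/(innov_cov th0 n (t n) (x n) _ _) -/(m n) -/(E1 n) -/(E2 n) => H.
  have N0 : n.+1%:R^-1 * (nll_sum n (t n) (x n) (th n) (d0 n) (d1 n) (b n)
      - nll_sum n (t n) (x n) th0 e0 e1 b0) <= 0.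
    by rewrite mulr_ge0_le0// subr_le0.
  have {}H := le_trans H N0.
  have lipm := mean_contrast_lipschitz (m n ord0 ord0) (m n ord0 ord_max)
    (m n ord_max ord_max) e0 (b0 * e0) (e1 + b0 ^+ 2 * e0) k1.
  have /ler_normlP[lip _] :=
    lipm _ _ _ (d0_gt0 n) (d1_gt0 n) (d0V n) (d1V n) (bk n).
  have /ler_normlP[_ lip0] := lipm _ _ _ e00 e10 e0V e1V b0k.
  rewrite -/(dm n) -/M in lip lip0.
  (* At the true parameter the mean contrast is the dimension 2, the constant subtracted in [G]. *)
  have X0 : mean_contrast e0 e1 b0 e0 (b0 * e0) (e1 + b0 ^+ 2 * e0) = 2.
    by rewrite /mean_contrast; field; rewrite !gt_eqF.
  rewrite X0 in lip0; rewrite /G.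
  set X := mean_contrast _ _ _ e0 _ _ in lip *.
  set Y := mean_contrast _ _ _ (m n _ _) _ _ in H lip.
  set Y0 := mean_contrast _ _ _ (m n _ _) _ _ in H lip0.
  have V1 : 0 <= (d1 n)^-1 by rewrite invr_ge0 ltW.
  have V0 : 0 <= (d0 n)^-1 by rewrite invr_ge0 ltW.
  have bb : (b0 - b n) ^+ 2 <= (2 * kappa) ^+ 2.
    rewrite -[leLHS]real_normK ?num_real//.
    apply: lerXn2r; rewrite ?nnegrE ?mulr_ge0//.
    by rewrite (le_trans (ler_normB _ _))// mulr_natl mulr2n lerD.
  have XE : X = e0 / d0 n + (e1 + (b0 - b n) ^+ 2 * e0) / d1 n.
    by rewrite /X /mean_contrast; ring.
  have be : 0 <= (b0 - b n) ^+ 2 * e0 by rewrite mulr_ge0 ?sqr_ge0 ?ltW.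
  have X_ge0 : 0 <= X.
    by rewrite XE addr_ge0 ?mulr_ge0 ?(ltW e00)// addr_ge0 ?(ltW e10).
  have XC : X <= kappa * kappa + (kappa + (2 * kappa) ^+ 2 * kappa) * kappa.
    rewrite XE; apply: lerD; apply: ler_pM => //; rewrite ?(ltW e00)//.
      by rewrite addr_ge0 ?(ltW e10).
    by apply: lerD => //; apply: ler_pM; rewrite ?sqr_ge0 ?(ltW e00).
  have dm_ge0 : 0 <= dm n by rewrite !addr_ge0.
  have r0 := r_ge0 n; have rk := r_le n.
  set r := th0 / th n in r0 rk H *.
  have h1 : 0 <= (1 - eta) * r * (Y - X + M * dm n).
    by apply: mulr_ge0; [rewrite mulr_ge0// subr_ge0|lra].
  have h2 : 0 <= eta * (r * (M * dm n)).
    by apply: mulr_ge0; [exact: ltW|apply: mulr_ge0 => //; exact: mulr_ge0].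
  have h3 : eta * (r * X) <= eta * C.
    by rewrite ler_wpM2l ?(ltW eta0)//; exact: ler_pM.
  have h4 : r * (M * dm n) <= kappa ^+ 2 * (M * dm n).
    by apply: ler_wpM2r => //; exact: mulr_ge0.
  have h5 : r * (K2 * M * E1 n) <= kappa ^+ 2 * (K2 * M * E1 n).
    by apply: ler_wpM2r => //; apply: mulr_ge0 => //; exact: mulr_ge0.
  rewrite /v; clearbody M K1 K2 K3 C Y X Y0 r.
  move: (dm n) (E1 n) (E2 n) h1 h2 h3 h4 h5 H lip0 => dm' E1' E2'.
  move: (n.+1%:R^-1) (kappa ^+ 2) => N kap2; move: (eta^-1) => etaV.
  move=> h1 h2 h3 h4 h5 H lip0'; lra.
- move=> eta /andP[eta0 _].
  have dist (u : nat -> R) (l : R) : u @ \oo --> l -> `|u n - l| @[n --> \oo] --> (0 : R).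
    move=> ul; rewrite -(@normr0 _ R); apply: cvg_norm.
    by rewrite -(subrr l); apply: cvgB => //; exact: cvg_cst.
  have dm0 : dm n @[n --> \oo] --> 0.
    rewrite -(addr0 0) -{1}(addr0 0).
    by apply: cvgD; [apply: cvgD|]; exact: dist.
  have cz (c : R) (u : nat -> R) : u @ \oo --> 0 -> c * u n @[n --> \oo] --> 0.
    by move=> u0; rewrite -(mulr0 c); apply: cvgM => //; exact: cvg_cst.
  rewrite -(addr0 0) -{1}(addr0 0) -{1}(addr0 0).
  apply: cvgD; last exact: cz.
  apply: cvgD; last by apply: (cz); exact: cz.
  apply: cvgD; first by apply: (cz); exact: cz.
  by apply: cz; exact: cvg_harmonic.
Qed.

Let component_cvg (f : nat -> R) : (forall n, 0 <= f n) -> (forall n, f n <= G n) ->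
  f n @[n --> \oo] --> 0.
Proof.
move=> f0 fG; apply: (squeeze_cvgr _ (cvg_cst 0) G_cvg0).
by apply: nearW => n; rewrite f0 fG.
Qed.

Let consistency_scale0 : th n * d0 n @[n --> \oo] --> th0 * e0.
Proof.
apply: cvg_sqrt_ratio; first exact: mulr_gt0.
  by move=> n; exact: mulr_gt0.
apply: component_cvg => n; first exact: sqr_ge0.
apply: le_trans (G_ge n); rewrite -addrA lerDl.
by rewrite addr_ge0 ?sqr_ge0.
Qed.

Let consistency_scale1 : th n * d1 n @[n --> \oo] --> th0 * e1.
Proof.
apply: cvg_sqrt_ratio; first exact: mulr_gt0.
  by move=> n; exact: mulr_gt0.
apply: component_cvg => n; first exact: sqr_ge0.
apply: le_trans (G_ge n); rewrite addrAC lerDr.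
by rewrite addr_ge0 ?sqr_ge0.
Qed.

Let consistency_slope : b n @[n --> \oo] --> b0.
Proof.
(* Lower bound for the weight [th0 / th n * (e0 / d1 n)]: each of its four factors is at least
   [kappa^-1]. *)
pose c := kappa ^- 4.
have kp : 0 < kappa by exact: lt_le_trans ltr01 k1.
have c0 : 0 < c by rewrite invr_gt0 exprn_gt0.
have h : c * (b n - b0) ^+ 2 @[n --> \oo] --> 0.
  apply: component_cvg => n; first by rewrite mulr_ge0 ?sqr_ge0// ltW.
  apply: le_trans (G_ge n); apply: (@le_trans _ _
    (th0 / th n * (e0 / d1 n) * (b n - b0) ^+ 2)); last first.
    by rewrite lerDr addr_ge0 ?sqr_ge0.
  rewrite ler_wpM2r ?sqr_ge0// /c (_ : kappa ^- 4 = (kappa^-1 * kappa^-1) * (kappa^-1 * kappa^-1)).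
    have iV (y : R) : 0 < y -> y^-1 <= kappa -> kappa^-1 <= y.
      by move=> y0 yk; rewrite -[y]invrK lef_pV2 ?posrE ?invr_gt0.
    have iV' (y : R) : 0 < y -> y <= kappa -> kappa^-1 <= y^-1.
      by move=> y0 yk; rewrite lef_pV2 ?posrE.
    have kV0 : 0 <= kappa^-1 by rewrite invr_ge0.
    by apply: ler_pM; rewrite ?mulr_ge0//; apply: ler_pM => //;
      [exact: iV|exact: iV'|exact: iV|exact: iV'].
  by field; rewrite gt_eqF.
have h1 : (b n - b0) ^+ 2 @[n --> \oo] --> 0.
  have : c^-1 * (c * (b n - b0) ^+ 2) @[n --> \oo] --> c^-1 * 0.
    by apply: cvgM h; exact: cvg_cst.
  by rewrite mulr0; under eq_fun do rewrite mulrA mulVf ?mul1r ?gt_eqF//.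
have : b n - b0 + b0 @[n --> \oo] --> 0 + b0.
  by apply: cvgD; [exact: cvg0_of_exprn h1|exact: cvg_cst].
by rewrite add0r; under eq_fun do rewrite subrK.
Qed.

Lemma consistency : [/\ th n * d0 n @[n --> \oo] --> th0 * e0,
  th n * d1 n @[n --> \oo] --> th0 * e1 & b n @[n --> \oo] --> b0].
Proof. by split. Qed.

End consistency.

(** * Innovations of the process *)

Section gaussian_innovations.
Context (R : realType) d (T : measurableType d) (P : probability T R).
Variables (Z : 'I_2 -> R -> {RV P >-> R}) (psi : param R).
Hypothesis hZ : has_law P psi Z.
Hypothesis theta_gt0 : 0 < theta psi.

Definition marginal_cov i j : R :=
  sigma psi i * sigma psi j * (rho psi + (1 - rho psi) * (i == j)%:R).

Section one_design.
Variables (n : nat) (t : nat -> R).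
Hypothesis t01 : forall k, t k \in `[0, 1].
Hypothesis tS : forall i, (i < n)%N -> t i < t i.+1.

Let th := theta psi.
Let x w i k : R := Z i (t k) w.

Let tm i j : (i <= j <= n)%N -> t i <= t j.
Proof. exact: increasing_le tS. Qed.

Lemma innov_product_mean i j k l : (k <= n)%N -> (l <= n)%N ->
  has_mean P (fun w => innov th t (x w i) k * innov th t (x w j) l)
    (marginal_cov i j * ((k == l)%:R * innov_var th t k)).
Proof.
move=> kn ln.
have pm k' l' := process_product_mean hZ i j (t01 k') (t01 l').
have covE k' l' : cross_cov psi i j (t k') (t l')
    = marginal_cov i j * ou th t k' l' by [].
rewrite -(innov_decorrelated th tm kn ln).
have -> : marginal_cov i j * (ou th t k l - ar th t k * ou th t k.-1 l
      - ar th t l * (ou th t k l.-1 - ar th t k * ou th t k.-1 l.-1))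
  = marginal_cov i j * ou th t k l
    + (- ar th t k) * (marginal_cov i j * ou th t k.-1 l)
    + (- ar th t l) * (marginal_cov i j * ou th t k l.-1)
    + (ar th t k * ar th t l) * (marginal_cov i j * ou th t k.-1 l.-1) by ring.
rewrite -!covE.
apply: has_mean_eq (has_meanD (has_meanD (has_meanD (pm k l)
  (has_meanZ (- ar th t k) (pm k.-1 l))) (has_meanZ (- ar th t l) (pm k l.-1)))
  (has_meanZ (ar th t k * ar th t l) (pm k.-1 l.-1))) => w.
by rewrite /innov /x; ring.
Qed.

Lemma std_innov_product_mean i j k l : (k <= n)%N -> (l <= n)%N ->
  has_mean P (fun w => std_innov th t (x w) i k * std_innov th t (x w) j l)
    (marginal_cov i j * (k == l)%:R).
Proof.
move=> kn ln.
pose s k := (Num.sqrt (innov_var th t k))^-1.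
have := has_meanZ (s k * s l) (innov_product_mean i j kn ln).
have -> : s k * s l * (marginal_cov i j * ((k == l)%:R * innov_var th t k))
    = marginal_cov i j * (k == l)%:R.
  case: eqP => [<-|_]; last by rewrite !(mul0r, mulr0).
  have v0 : 0 < innov_var th t k by exact: (innov_var_gt0 theta_gt0 tS).
  rewrite /s -invfM -expr2 sqr_sqrtr ?ltW// !mul1r mulr1.
  by rewrite mulrCA mulVf ?mulr1// gt_eqF.
by apply: has_mean_eq => w; rewrite /std_innov /s; ring.
Qed.

Variable c : 'I_2 -> R.

(** The strong law concerns scalar arrays, so the two components are combined linearly; their
    covariances are recovered by polarization. *)
Definition combined_innov w k : R := \sum_i c i * std_innov th t (x w) i k.

Definition combined_var : R := \sum_i \sum_j c i * c j * marginal_cov i j.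

(** A combination of innovations is one of process values, hence Gaussian, and its variance follows
    from decorrelation. The result is the hypothesis of the strong law with [tau = combined_var]. *)
Lemma combined_innov_mgf (v : 'I_n.+1 -> R) :
  has_mean P (fun w => expR (\sum_k v k * combined_innov w k))
    (expR (combined_var * (\sum_k v k ^+ 2) / 2)).
Proof.
pose s k := (Num.sqrt (innov_var th t k))^-1.
(* Each innovation involves two values of the process; the boolean chooses between the times [t k]
   and [t k.-1]. *)
pose I := ('I_n.+1 * 'I_2 * bool)%type.
pose co (q : I) := v q.1.1 * c q.1.2 * s q.1.1 *
  (if q.2 then 1 else - ar th t q.1.1).
pose ti (q : I) := if q.2 then t q.1.1 else t q.1.1.-1.
have XE w : \sum_q co q * Z q.1.2 (ti q) w = \sum_k v k * combined_innov w k.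
  rewrite -(pair_bigA _ (fun p b => co (p, b) * Z p.2 (ti (p, b)) w))/=.
  rewrite -(pair_bigA _ (fun k i => \sum_b co (k, i, b) * Z i (ti (k, i, b)) w))/=.
  apply: eq_bigr => k _; rewrite /combined_innov mulr_sumr.
  apply: eq_bigr => i _; rewrite big_bool /co /ti/= /std_innov /innov /s /x; ring.
have ti01 q : ti q \in `[0, 1] by rewrite /ti; case: ifP.
have X2 : has_mean P (fun w => (\sum_q co q * Z q.1.2 (ti q) w) ^+ 2)
    (combined_var * (\sum_k v k ^+ 2)).
  have -> : combined_var * (\sum_k v k ^+ 2) = \sum_k \sum_l v k * v l *
      (\sum_i \sum_j c i * c j * (marginal_cov i j * (k == l :> nat)%:R)).
    rewrite mulr_sumr; apply: eq_bigr => k _.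
    rewrite (bigD1 k)//= [X in _ + X]big1 ?addr0 => [|l lk].
      by rewrite eqxx expr2 mulrC; under [in RHS]eq_bigr do under eq_bigr do rewrite mulr1.
    rewrite [X in _ * X]big1 ?mulr0// => i _; rewrite big1// => j _.
    by rewrite -val_eqE eq_sym in lk; rewrite (negbTE lk) !mulr0.
  apply: (@has_mean_eq _ _ _ _ (fun w => \sum_k \sum_l v k * v l *
      (\sum_i \sum_j c i * c j *
        (std_innov th t (x w) i k * std_innov th t (x w) j l)))).
    move=> w; rewrite XE expr2 mulr_suml; apply: eq_bigr => k _.
    rewrite mulr_sumr; apply: eq_bigr => l _; rewrite mulrACA; congr (_ * _).
    rewrite /combined_innov mulr_suml; apply: eq_bigr => i _.
    by rewrite mulr_sumr; apply: eq_bigr => j _; rewrite mulrACA.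
  apply: (has_mean_sum _ (F := fun k w => \sum_(l < n.+1) v k * v l *
      (\sum_i \sum_j c i * c j *
        (std_innov th t (x w) i k * std_innov th t (x w) j l)))) => k _.
  apply: (has_mean_sum _ (F := fun (l : 'I_n.+1) w => v k * v l *
      (\sum_i \sum_j c i * c j *
        (std_innov th t (x w) i k * std_innov th t (x w) j l)))) => l _.
  apply: has_meanZ.
  apply: (has_mean_sum _ (F := fun i w => \sum_j c i * c j *
        (std_innov th t (x w) i k * std_innov th t (x w) j l))) => i _.
  apply: (has_mean_sum _ (F := fun j w => c i * c j *
        (std_innov th t (x w) i k * std_innov th t (x w) j l))) => j _.
  by apply: has_meanZ; apply: std_innov_product_mean; rewrite -ltnS.
by apply: has_mean_eq (process_mgf hZ ti01 X2) => w; rewrite XE.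
Qed.

Lemma measurable_std_innov i k :
  measurable_fun setT (fun w => std_innov th t (x w) i k).
Proof.
apply: measurable_funM => //; apply: measurable_funB => //.
exact: measurable_funM.
Qed.

Lemma measurable_combined_innov k :
  measurable_fun setT (fun w => combined_innov w k).
Proof.
rewrite /combined_innov; under eq_fun do rewrite big_ord2/=.
by apply: measurable_funD; apply: measurable_funM => //;
  exact: measurable_std_innov.
Qed.

End one_design.

Lemma process_exp_mean i t : t \in `[0, 1] ->
  has_mean P (fun w => expR (Z i t w) + expR (- Z i t w))
    (expR (marginal_cov i i / 2) + expR (marginal_cov i i / 2)).
Proof.
move=> t01.
have pm := process_product_mean hZ i i t01 t01.
have covE : cross_cov psi i i t t = marginal_cov i i.
  by rewrite /cross_cov subrr normr0 mulr0 expR0 mulr1.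
rewrite covE in pm.
have h (s : R) : s ^+ 2 = 1 ->
    has_mean P (fun w => expR (s * Z i t w)) (expR (marginal_cov i i / 2)).
  move=> s1.
  have X2 : has_mean P (fun w => (\sum_(q : 'I_1) s * Z i t w) ^+ 2)
      (marginal_cov i i).
    apply: has_mean_eq pm => w; rewrite big_ord1 exprMn s1 mul1r expr2//.
  have := process_mgf hZ (fun _ : 'I_1 => t01) X2.
  by apply: has_mean_eq => w; rewrite big_ord1.
apply: (@has_mean_eq _ _ _ _ (fun w => expR (1 * Z i t w) + expR (- 1 * Z i t w))).
  by move=> w; rewrite mul1r mulN1r.
by apply: has_meanD; apply: h; rewrite ?sqrrN expr1n.
Qed.

End gaussian_innovations.

(** * Almost sure limits along the designs *)

Section almost_sure_limits.
Context (R : realType) d (T : measurableType d) (P : probability T R).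
Variables (Z : 'I_2 -> R -> {RV P >-> R}) (psi : param R).
Hypothesis hZ : has_law P psi Z.
Hypothesis theta_gt0 : 0 < theta psi.
Hypothesis rho_lt1 : -1 < rho psi < 1.
Variable t : nat -> nat -> R.
Hypothesis t01 : forall n k, t n k \in `[0, 1].
Hypothesis tS : forall n i, (i < n)%N -> t n i < t n i.+1.

Let th := theta psi.
Let x n w i k : R := Z i (t n k) w.

Lemma marginal_covC i j : marginal_cov psi i j = marginal_cov psi j i.
Proof. by rewrite /marginal_cov eq_sym; ring. Qed.

Lemma combined_var_ge0 c : 0 <= combined_var psi c.
Proof.
have /andP[r1 r2] := rho_lt1.
rewrite /combined_var !big_ord2/= /marginal_cov.
rewrite !eqxx (_ : (ord_max == ord0 :> 'I_2) = false)//.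
rewrite (_ : (ord0 == ord_max :> 'I_2) = false)//.
set a := sigma psi ord0; set b := sigma psi ord_max; set r := rho psi.
rewrite [leRHS](_ : _ = (c ord0 * a + r * c ord_max * b) ^+ 2
   + (1 - r ^+ 2) * (c ord_max * b) ^+ 2); last by rewrite mulr1n mulr0n; ring.
rewrite addr_ge0 ?sqr_ge0// mulr_ge0 ?sqr_ge0// subr_ge0.
by rewrite -real_normK ?num_real// exprn_ile1// ler_norml (ltW r1) ltW.
Qed.

Lemma ae_cvg_combined_innov c : {ae P, forall w,
  avg n (fun k => combined_innov Z psi (t n) c w k ^+ 2) @[n --> \oo]
    --> combined_var psi c}.
Proof.
apply: (@ae_cvg_empirical_second_moment _ _ _ P
  (fun n k w => combined_innov Z psi (t n) c w k)).
- exact: combined_var_ge0.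
- by move=> n k; exact: measurable_combined_innov.
- by move=> n v; exact: (combined_innov_mgf hZ theta_gt0 (t01 n) (@tS n)).
Qed.

(* By polarization. *)
Lemma ae_cvg_innov_cov : {ae P, forall w,
  [/\ innov_cov th n (t n) (x n w) ord0 ord0 @[n --> \oo]
        --> marginal_cov psi ord0 ord0,
      innov_cov th n (t n) (x n w) ord0 ord_max @[n --> \oo]
        --> marginal_cov psi ord0 ord_max &
      innov_cov th n (t n) (x n w) ord_max ord_max @[n --> \oo]
        --> marginal_cov psi ord_max ord_max]}.
Proof.
pose c0 (i : 'I_2) : R := if i == ord0 then 1 else 0.
pose c1 (i : 'I_2) : R := if i == ord0 then 0 else 1.
have v0 : combined_var psi c0 = marginal_cov psi ord0 ord0.
  by rewrite /combined_var !big_ord2/= /c0/=; ring.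
have v1 : combined_var psi c1 = marginal_cov psi ord_max ord_max.
  by rewrite /combined_var !big_ord2/= /c1/=; ring.
have v2 : combined_var psi (fun=> 1) = marginal_cov psi ord0 ord0
    + 2 * marginal_cov psi ord0 ord_max + marginal_cov psi ord_max ord_max.
  rewrite /combined_var !big_ord2/= (marginal_covC ord_max); ring.
apply: (filterS3 _ _ (ae_cvg_combined_innov c0) (ae_cvg_combined_innov c1)
  (ae_cvg_combined_innov (fun=> 1))) => w.
rewrite v0 v1 v2 => h0 h1 h2.
have E0 n : avg n (fun k => combined_innov Z psi (t n) c0 w k ^+ 2)
    = innov_cov th n (t n) (x n w) ord0 ord0.
  by congr (_ * _); apply: eq_bigr => k _;
    rewrite /combined_innov big_ord2/= /c0/=; ring.
have E1 n : avg n (fun k => combined_innov Z psi (t n) c1 w k ^+ 2)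
    = innov_cov th n (t n) (x n w) ord_max ord_max.
  by congr (_ * _); apply: eq_bigr => k _;
    rewrite /combined_innov big_ord2/= /c1/=; ring.
have E2 n : innov_cov th n (t n) (x n w) ord0 ord_max
    = (avg n (fun k => combined_innov Z psi (t n) (fun=> 1) w k ^+ 2)
      - innov_cov th n (t n) (x n w) ord0 ord0
      - innov_cov th n (t n) (x n w) ord_max ord_max) / 2.
  rewrite /innov_cov -!avgB mulrC -avgZ; congr (_ * _); apply: eq_bigr => k _.
  rewrite /combined_innov big_ord2/=.
  by rewrite -!/(x _ _ _ _) /x; field.
rewrite (funext E0) in h0; rewrite (funext E1) in h1.
split => //; under eq_fun do rewrite E2.
have -> : marginal_cov psi ord0 ord_max = (marginal_cov psi ord0 ord0
    + 2 * marginal_cov psi ord0 ord_max + marginal_cov psi ord_max ord_max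
    - marginal_cov psi ord0 ord0 - marginal_cov psi ord_max ord_max) / 2.
  by field.
by apply: cvgM; [apply: cvgB => //; exact: cvgB|exact: cvg_cst].
Qed.

Let gap_sum n : \sum_(k < n.+1) gap (t n) k <= 2.
Proof.
rewrite sum_gap; have := t01 n n; have := t01 n 0%N.
by rewrite !in_itv/= => /andP[? _] /andP[_ ?]; lra.
Qed.

Let ae_weighted (X : nat -> nat -> T -> R) (K : R) :
    (forall n k, measurable_fun setT (X n k)) ->
    (forall n k, (k <= n)%N -> exists2 m,
      has_mean P (fun w => expR (X n k w) + expR (- X n k w)) m & m <= K) ->
  {ae P, forall w, avg n (fun k => gap (t n) k * X n k w ^+ 2) @[n --> \oo] --> 0}.
Proof.
move=> mX XK.
apply: (ae_cvg0_weighted_squares (S := 2) (delta := fun n k => gap (t n) k)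
  _ mX XK) => // n k kn.
exact/ltW/(gap_gt0 (@tS n)).
Qed.

(** An instance of [combined_innov_mgf]: [c] selects the component [i], and [dl s] the index [k]
    with sign [s]. *)
Let std_innov_exp_mean i n k : (k <= n)%N -> exists2 m,
  has_mean P (fun w => expR (std_innov th (t n) (x n w) i k)
    + expR (- std_innov th (t n) (x n w) i k)) m &
  m <= 2 * expR (marginal_cov psi i i / 2).
Proof.
move=> kn; pose c j : R := (j == i)%:R.
pose dl (s : R) (l : 'I_n.+1) : R := s * (l == inord k)%:R.
have kE : nat_of_ord (inord k : 'I_n.+1) = k by rewrite inordK.
have vE : combined_var psi c = marginal_cov psi i i.
  rewrite /combined_var (bigD1 i)//= (bigD1 i)//= /c eqxx.
  rewrite big1 ?addr0 => [|j /negbTE ->]; last by rewrite mulr0 mul0r.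
  rewrite big1 ?addr0 ?mulr1 ?mul1r// => l /negbTE ->.
  by rewrite big1// => j _; rewrite !mul0r.
have cE w l : combined_innov Z psi (t n) c w l = std_innov th (t n) (x n w) i l.
  rewrite /combined_innov (bigD1 i)//= /c eqxx mul1r big1 ?addr0// => j.
  by move=> /negbTE ->; rewrite mul0r.
have h (s : R) : s ^+ 2 = 1 -> has_mean P
    (fun w => expR (s * std_innov th (t n) (x n w) i k))
    (expR (marginal_cov psi i i / 2)).
  move=> s1.
  have := combined_innov_mgf hZ theta_gt0 (t01 n) (@tS n) c (dl s).
  have -> : \sum_l dl s l ^+ 2 = 1.
    rewrite (bigD1 (inord k))//= /dl eqxx mulr1 s1 big1 ?addr0// => l /negbTE ->.
    by rewrite mulr0 expr0n.
  rewrite vE mulr1; apply: has_mean_eq => w; congr expR.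
  rewrite (bigD1 (inord k))//= /dl eqxx mulr1 cE kE big1 ?addr0// => l /negbTE ->.
  by rewrite mulr0 mul0r.
exists (expR (marginal_cov psi i i / 2) + expR (marginal_cov psi i i / 2)).
  apply: (@has_mean_eq _ _ _ _ (fun w =>
    expR (1 * std_innov th (t n) (x n w) i k)
    + expR (-1 * std_innov th (t n) (x n w) i k))).
    by move=> w; rewrite mul1r mulN1r.
  by apply: has_meanD; apply: h; rewrite ?sqrrN expr1n.
by rewrite mulr_natl mulr2n.
Qed.

Lemma ae_cvg_innov_energy : {ae P, forall w,
  innov_energy th n (t n) (x n w) @[n --> \oo] --> 0}.
Proof.
have h i : {ae P, forall w, avg n (fun k =>
    gap (t n) k * std_innov th (t n) (x n w) i k ^+ 2) @[n --> \oo] --> 0}.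
  apply: (@ae_weighted (fun n k w => std_innov th (t n) (x n w) i k)).
    by move=> n k; exact: measurable_std_innov.
  exact: std_innov_exp_mean.
apply: (filterS2 _ _ (h ord0) (h ord_max)) => w h0 h1.
have E n : innov_energy th n (t n) (x n w)
    = avg n (fun k => gap (t n) k * std_innov th (t n) (x n w) ord0 k ^+ 2)
    + avg n (fun k => gap (t n) k * std_innov th (t n) (x n w) ord_max k ^+ 2).
  by rewrite -avgD; congr (_ * _); apply: eq_bigr => k _; rewrite mulrDr.
by rewrite (funext E) -(addr0 0); exact: cvgD.
Qed.

Lemma ae_cvg_lag_energy : {ae P, forall w,
  lag_energy n (t n) (x n w) @[n --> \oo] --> 0}.
Proof.
have h i : {ae P, forall w, avg n (fun k =>
    gap (t n) k * x n w i k.-1 ^+ 2) @[n --> \oo] --> 0}.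
  apply: (@ae_weighted (fun n k w => x n w i k.-1)).
    by move=> n k; exact: measurable_funP.
  move=> n k _; eexists; first exact: (process_exp_mean hZ).
  exact: lexx.
apply: (filterS2 _ _ (h ord0) (h ord_max)) => w h0 h1.
have E n : lag_energy n (t n) (x n w)
    = avg n (fun k => gap (t n) k * x n w ord0 k.-1 ^+ 2)
    + avg n (fun k => gap (t n) k * x n w ord_max k.-1 ^+ 2).
  by rewrite -avgD; congr (_ * _); apply: eq_bigr => k _; rewrite mulrDr.
by rewrite (funext E) -(addr0 0); exact: cvgD.
Qed.

End almost_sure_limits.

(** * Uniform bounds on the box *)

Section box_bounds.
Context (R : realType).
Variables (atheta btheta : R) (asig bsig : 'I_2 -> R) (arho brho : R).
Hypothesis atheta_gt0 : 0 < atheta.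
Hypothesis asig_gt0 : forall i, 0 < asig i.
Hypotheses (arho_gtN1 : -1 < arho) (brho_lt1 : brho < 1).

Lemma box_in_bounds : exists2 kappa, 1 <= kappa &
  forall psi, box atheta btheta asig bsig arho brho psi ->
  in_bounds kappa (theta psi) (sigsq psi ord0) (cond_var psi) (cond_slope psi).
Proof.
(* If the interval for [rho] is empty, so is the box, and any [kappa >= 1] will do. *)
have [|rN] := ltP brho arho.
  move=> rr; exists 1 => // psi [_ _]; rewrite in_itv/= => /andP[h1 h2].
  by move: (le_trans h1 h2); rewrite leNgt rr.
(* Since [|rho|] is at most [m < 1] on the box, the conditional variance is at least
   [asig ord_max * (1 - m ^+ 2)], the inverse of [q] below. *)
pose m := Num.max `|arho| `|brho|.
have m0 : 0 <= m by rewrite le_max normr_ge0.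
have m1 : m < 1.
  by rewrite gt_max !ltr_norml arho_gtN1 brho_lt1 (le_lt_trans rN) ?(lt_le_trans _ rN).
have q0 : 0 < 1 - m ^+ 2 by rewrite subr_gt0 expr_lt1.
pose q := (asig ord_max * (1 - m ^+ 2))^-1.
pose sl := Num.sqrt (bsig ord_max) / Num.sqrt (asig ord0).
pose kappa := 1 + `|btheta| + `|atheta^-1| + `|bsig ord0| + `|(asig ord0)^-1|
  + `|bsig ord_max| + `|q| + `|sl|.
have part (y : R) : y \in [:: btheta; atheta^-1; bsig ord0; (asig ord0)^-1;
    bsig ord_max; q; sl] -> y <= kappa.
  rewrite !inE /kappa => hy.
  have := normr_ge0 btheta; have := normr_ge0 atheta^-1.
  have := normr_ge0 (bsig ord0); have := normr_ge0 (asig ord0)^-1.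
  have := normr_ge0 (bsig ord_max); have := normr_ge0 q; have := normr_ge0 sl.
  have := ler_norm y.
  by do ![case/predU1P: hy => [-> ? ? ? ? ? ? ? ?|hy]]; [lra..|];
    move: hy => /eqP -> ? ? ? ? ? ? ? ?; lra.
exists kappa.
  by rewrite /kappa -!addrA lerDl !addr_ge0.
move=> psi psiJ; have [th0 s0 r1] := box_valid atheta_gt0 asig_gt0 arho_gtN1 brho_lt1 psiJ.
case: psiJ => + hs; rewrite !in_itv/= => /andP[h1 h2] /andP[h3 h4].
have hs0 := hs ord0; have hs1 := hs ord_max.
rewrite !in_itv/= in hs0 hs1.
have /andP[s00 s01] := hs0; have /andP[s10 s11] := hs1.
have rm : `|rho psi| <= m.
  rewrite le_max !ler_norml; have [r0|r0] := leP 0 (rho psi).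
    apply/orP; right; rewrite (le_trans h4 (ler_norm _)) andbT.
    by rewrite (le_trans _ r0)// oppr_le0.
  apply/orP; left; rewrite (le_trans (ltW r0))// andbT lerNl.
  by apply: (@le_trans _ _ (- arho)); rewrite ?lerN2// -normrN ler_norm.
have r2m : rho psi ^+ 2 <= m ^+ 2.
  by rewrite -real_normK ?num_real//; apply: lerXn2r; rewrite ?nnegrE.
have cv0 := cond_var_gt0 s0 r1.
split.
- split => //; first by rewrite (le_trans h2)// part// !inE eqxx.
  by apply: (@le_trans _ _ atheta^-1);
    [rewrite lef_pV2 ?posrE|rewrite part// !inE eqxx ?orbT].
- split => //; first by rewrite (le_trans s01)// part// !inE eqxx ?orbT.
  by apply: (@le_trans _ _ (asig ord0)^-1);
    [rewrite lef_pV2 ?posrE|rewrite part// !inE eqxx ?orbT].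
- split => //.
    apply: (@le_trans _ _ (bsig ord_max)); last by rewrite part// !inE eqxx ?orbT.
    apply: le_trans s11; rewrite /cond_var ler_piMr ?(ltW (s0 _))//.
    by rewrite lerBlDr lerDl sqr_ge0.
  apply: (@le_trans _ _ q); last by rewrite part// !inE eqxx ?orbT.
  rewrite lef_pV2 ?posrE//; last by rewrite mulr_gt0.
  by apply: ler_pM => //; rewrite ?(ltW q0) ?(ltW (asig_gt0 _))//; lra.
- apply: (@le_trans _ _ sl); last by rewrite part// !inE eqxx ?orbT.
  rewrite /cond_slope /sigma !normrM normfV.
  rewrite (ger0_norm (sqrtr_ge0 _)) (ger0_norm (sqrtr_ge0 _)).
  apply: ler_pM; rewrite ?mulr_ge0 ?invr_ge0 ?sqrtr_ge0//.
    rewrite -[leRHS]mul1r; apply: ler_pM; rewrite ?sqrtr_ge0//.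
      exact: le_trans rm (ltW m1).
    exact: ler_wsqrtr.
  by rewrite lef_pV2 ?posrE ?sqrtr_gt0//; exact: ler_wsqrtr.
Qed.

End box_bounds.

(** * Return to the original parameters and strong consistency *)

Lemma rho_of_scales (R : realType) (psi : param R) : 0 < theta psi ->
    (forall i, 0 < sigsq psi i) ->
  rho psi = cond_slope psi * Num.sqrt (theta psi * sigsq psi ord0)
    / Num.sqrt (theta psi * sigsq psi ord_max).
Proof.
move=> th0 s0; rewrite /cond_slope /sigma !sqrtrM ?(ltW th0)//.
have a0 : Num.sqrt (sigsq psi ord0) != 0 by rewrite gt_eqF// sqrtr_gt0.
have b0 : Num.sqrt (sigsq psi ord_max) != 0 by rewrite gt_eqF// sqrtr_gt0.
have c0 : Num.sqrt (theta psi) != 0 by rewrite gt_eqF// sqrtr_gt0.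
by field; rewrite a0 b0 c0.
Qed.

(** Decomposition of the variance of the second component into its residual part and the part
    explained by the first. *)
Lemma sigsq1E (R : realType) (psi : param R) : (forall i, 0 < sigsq psi i) ->
  sigsq psi ord_max = cond_var psi + cond_slope psi ^+ 2 * sigsq psi ord0.
Proof.
move=> s0; rewrite /cond_slope /cond_var /sigma !exprMn exprVn.
rewrite !sqr_sqrtr ?(ltW (s0 _))//; field; rewrite gt_eqF//.
Qed.

Lemma marginal_cov_diag (R : realType) (psi : param R) i : 0 < sigsq psi i ->
  marginal_cov psi i i = sigsq psi i.
Proof.
move=> s0; rewrite /marginal_cov eqxx mulr1 addrCA subrr addr0 mulr1 -expr2.
by rewrite sqr_sqrtr ?ltW.
Qed.

Lemma marginal_cov01 (R : realType) (psi : param R) : 0 < sigsq psi ord0 ->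
  marginal_cov psi ord0 ord_max = cond_slope psi * sigsq psi ord0.
Proof.
move=> s0; rewrite /marginal_cov /cond_slope.
have a0 : sigma psi ord0 != 0 by rewrite gt_eqF// sqrtr_gt0.
have -> : sigsq psi ord0 = sigma psi ord0 ^+ 2 by rewrite sqr_sqrtr ?ltW.
by rewrite mulr0n mulr0 addr0; field.
Qed.

Theorem theorem3p2 (d : measure_display) (T : measurableType d) (R : realType)
  (P : probability T R) (Z : 'I_2 -> R -> {RV P >-> R}) (psi0 : param R)
  (s : forall n : nat, 'I_n -> R)
  (atheta btheta : R) (asig bsig : 'I_2 -> R) (arho brho : R)
  (psihat : nat -> T -> param R)
  (hZ : has_law P psi0 Z)
  (hs : design s) (hdense : becomes_dense s)
  (htheta : 0 < atheta /\ atheta <= theta psi0 <= btheta)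
  (hsig : forall i, 0 < asig i /\ asig i <= sigsq psi0 i <= bsig i)
  (hrho : [/\ -1 < arho, arho <= rho psi0 <= brho & brho < 1])
  (hpsihat : forall (n : nat) (w : T),
     let l := nll (fun i t => Z i t w) (s n) in
     let J := box atheta btheta asig bsig arho brho in
     (exists psi, is_argmin l J psi) -> is_argmin l J (psihat n w)) :
  [/\ {ae P, forall w, \forall n \near \oo,
         exists psi, is_argmin (nll (fun i t => Z i t w) (s n))
                       (box atheta btheta asig bsig arho brho) psi},
      {ae P, forall w, rho (psihat n w) @[n --> \oo] --> rho psi0} &
      (forall i : 'I_2, {ae P, forall w,
         theta (psihat n w) * sigsq (psihat n w) i @[n --> \oo]
           --> theta psi0 * sigsq psi0 i})].
Proof.
have [ath0 thJ] := htheta; have [ar1 rhoJ br1] := hrho.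
have as0 i : 0 < asig i by case: (hsig i).
have psi0J : box atheta btheta asig bsig arho brho psi0.
  by split; rewrite ?in_itv// => i; rewrite in_itv; case: (hsig i).
have [th0 s0 r1] := box_valid ath0 as0 ar1 br1 psi0J.
have [kappa k1 inb] := box_in_bounds btheta bsig ath0 as0 ar1 br1.
have sm n (k l : 'I_n) : (k < l)%N -> s n k < s n l by case: (hs n) => _; exact.
(* Designs are shifted to [n.+1] so that they are nonempty; [inord] extends the points to all
   natural indices, with the junk value [s n.+1 ord0] past the last one, still in the unit
   interval. *)
pose t n k := s n.+1 (inord k).
have t01 n k : t n k \in `[0, 1] by case: (hs n.+1) => h _; exact: h.
have tS n i : (i < n)%N -> t n i < t n i.+1.
  by move=> i_n; apply: sm; rewrite !inordK// ltnW.
have ex n w : exists psi, is_argmin (nll (fun i t => Z i t w) (s n.+1))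
    (box atheta btheta asig bsig arho brho) psi.
  by apply: (nll_argmin_exists _ _ ath0 as0 ar1 br1 psi0J); exact: sm.
(* Consistency is first obtained in the regression coordinates; the additive constant of the
   likelihood cancels in the comparison with the true parameter. *)
have main : {ae P, forall w,
  [/\ theta (psihat n.+1 w) * sigsq (psihat n.+1 w) ord0 @[n --> \oo]
        --> theta psi0 * sigsq psi0 ord0,
      theta (psihat n.+1 w) * cond_var (psihat n.+1 w) @[n --> \oo]
        --> theta psi0 * cond_var psi0 &
      cond_slope (psihat n.+1 w) @[n --> \oo] --> cond_slope psi0]}.
  have hA := ae_cvg_innov_cov hZ th0 r1 t01 tS.
  have hB := ae_cvg_innov_energy hZ th0 t01 tS.
  have hC := ae_cvg_lag_energy hZ t01 tS.
  apply: (filterS3 _ _ hA hB hC) => w [m00 m01 m11] E1 E2.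
  pose x n i k : R := Z i (t n k) w.
  apply: (@consistency _ kappa _ _ _ _ t x) => //.
  - exact: inb.
  - by move=> n; apply: inb; case: (hpsihat n.+1 w (ex n w)).
  - move=> n; have := t01 n n; have := t01 n 0%N.
    by rewrite !in_itv/= => /andP[? _] /andP[_ ?]; lra.
  - move=> n; have [hJ /(_ _ psi0J)] := hpsihat n.+1 w (ex n w).
    have [? ? ?] := box_valid ath0 as0 ar1 br1 hJ.
    by rewrite !nllE//; [rewrite lerD2l|exact: sm..].
  - by rewrite -marginal_cov_diag.
  - by rewrite -marginal_cov01.
  - by rewrite -sigsq1E// -marginal_cov_diag.
have valid n w := box_valid ath0 as0 ar1 br1 (hpsihat n.+1 w (ex n w)).1.
have hs0 n w i : 0 < sigsq (psihat n.+1 w) i by case: (valid n w).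
have hth0 n w : 0 < theta (psihat n.+1 w) by case: (valid n w).
have scale1 : {ae P, forall w,
    theta (psihat n.+1 w) * sigsq (psihat n.+1 w) ord_max @[n --> \oo]
      --> theta psi0 * sigsq psi0 ord_max}.
  apply: filterS main => w [h0 h1 hb].
  (* The decomposition of the second variance, multiplied by [theta], involves only quantities whose
     limits are known. *)
  have E (psi : param R) : (forall i, 0 < sigsq psi i) ->
      theta psi * sigsq psi ord_max = theta psi * cond_var psi
        + cond_slope psi * cond_slope psi * (theta psi * sigsq psi ord0).
    by move=> h; rewrite sigsq1E//; ring.
  rewrite E//; under eq_fun => n do rewrite (E _ (hs0 n w)).
  by apply: cvgD => //; apply: cvgM => //; exact: cvgM.
split.
(* A minimizer exists for every outcome and every [n >= 1], not only almost surely. *)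
- apply: aeW => w; exists 1%N => // -[//|n] _; exact: ex.
- apply: (filterS2 _ _ main scale1) => w [h0 _ hb] h1.
  rewrite -(cvg_shiftS (fun n => rho (psihat n w))).
  have csqrt (u : nat -> R) (l : R) : u @ \oo --> l ->
      Num.sqrt (u n) @[n --> \oo] --> Num.sqrt l.
    by move=> h; apply: (cvg_comp _ _ h); exact: sqrt_continuous.
  rewrite rho_of_scales//.
  under eq_fun => n do rewrite (rho_of_scales (hth0 n w) (hs0 n w)).
  apply: cvgM; first by apply: cvgM => //; exact: csqrt.
  apply: cvgV; last exact: csqrt.
  by rewrite gt_eqF// sqrtr_gt0 mulr_gt0.
- move=> i; case: (ord2P i) => ->.
    apply: filterS main => w [h0 _ _].
    by rewrite -(cvg_shiftS (fun n => theta (psihat n w) * sigsq (psihat n w) ord0)).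
  apply: filterS scale1 => w h1.
  by rewrite -(cvg_shiftS
    (fun n => theta (psihat n w) * sigsq (psihat n w) ord_max)).
Qed.
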